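(* For every real $p \ge 3$ there exists a constant $C_p > 0$, depending only on $p$, such that the following holds. For every integer $n \ge 1$ and all real numbers $a_1 \ge \ldots \ge a_n \ge 0$ with $\sum_{i=1}^n a_i^2 = 1$, if $\varepsilon_1, \ldots, \varepsilon_n$ are i.i.d. Rademacher random variables, $S = \sum_{i=1}^n a_i \varepsilon_i$, and $G$ is a standard Gaussian random variable, then $$\mathbb{E}|S|^p \le \mathbb{E}|G|^p - C_p \sum_{i=1}^n a_i^4 .$$
   Context: A Rademacher random variable $\varepsilon$ satisfies $\mathbb{P}(\varepsilon = 1) = \mathbb{P}(\varepsilon = -1) = \frac12$. *)

(* Defs.v *)
From mathcomp Require Export all_boot all_order all_algebra.
From mathcomp Require Export all_classical all_reals all_analysis.

Set Implicit Arguments.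
Unset Strict Implicit.
Unset Printing Implicit Defensive.

Import Order.TTheory GRing.Theory Num.Theory.
Import numFieldNormedType.Exports.

Local Open Scope classical_set_scope.
Local Open Scope ring_scope.

Definition mutually_independent d d' (T : measurableType d)
    (T' : measurableType d') (R : realType) (P : probability T R)
    (I : finType) (X : I -> {RV P >-> T'}) : Prop :=
  forall (J : {set I}) (A : I -> set T'),
    (forall i, i \in J -> measurable (A i)) ->
    P (\bigcap_(i in [set` J]) (X i @^-1` A i)) =
    (\prod_(i in J) P (X i @^-1` A i))%E.

Definition rademacher d (T : measurableType d) (R : realType)
    (P : probability T R) (X : {RV P >-> R}) : Prop :=
  P (X @^-1` [set 1]) = (2^-1)%:E /\ P (X @^-1` [set -1]) = (2^-1)%:E.

(* The second parameter of [normal_prob] is the standard deviation, not the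
   variance. *)
Definition standard_gaussian d (T : measurableType d) (R : realType)
    (P : probability T R) (X : {RV P >-> R}) : Prop :=
  forall A : set R, measurable A -> distribution P X A = normal_prob 0 1 A.

(* Main.v *)
(* For [p > 3], with [r = 1 / (p - 3)], scaling gives
     [`|x| `^ p = L^-1 * \int_0^oo (`|x| - w `^ r)_+ ^ 3 dw],
   so everything reduces to comparing [E (S - t)_+ ^ 3] with
   [E (G - t)_+ ^ 3]: the second dominates for every [t], with a gain of order
   [\sum a_i ^ 4] for [`|t| <= 1 / 2].

   The comparison replaces the summands [a_i eps_i] by Gaussians [a_i g_i] one
   at a time.  If [X] denotes the sum of the other terms, one replacement gains
   at least [c * a_i ^ 3] on the event [`|X - t| <= a_i].  Once the Gaussians
   already present have variance at least [1 / 8], this event has probability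
   of order [a_i], whence [a_i ^ 4].  If some [a_i ^ 2 >= 3 / 4], that single
   replacement is enough; otherwise the sequence splits into two pieces of
   variance at least [1 / 8], and treating either piece first gives the gain
   for all the terms of the other one. *)
Require Import Defs.
From mathcomp Require Import measurable_realfun ring lra.
Set Implicit Arguments.
Unset Strict Implicit.
Unset Printing Implicit Defensive.
Import Order.TTheory GRing.Theory Num.Theory.
Import numFieldNormedType.Exports.
Local Open Scope classical_set_scope.
Local Open Scope ring_scope.

(** * Positive parts of cubes and the pointwise comparison of a sign with a Gaussian *)

Definition cubepos {R : realType} (x : R) : R := Num.max x 0 ^+ 3.

Lemma cubepos_ge0 (R : realType) (x : R) : 0 <= cubepos x.
Proof. by rewrite exprn_ge0// le_max lexx orbT. Qed.

Lemma cubepos_pos (R : realType) (x : R) : 0 <= x -> cubepos x = x ^+ 3.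
Proof. by move=> x0; rewrite /cubepos max_l. Qed.

Lemma cubepos_neg (R : realType) (x : R) : x <= 0 -> cubepos x = 0.
Proof. by move=> x0; rewrite /cubepos max_r// expr0n. Qed.

Lemma cubeposM (R : realType) (a x : R) : 0 <= a ->
  cubepos (a * x) = a ^+ 3 * cubepos x.
Proof.
by move=> a0; rewrite /cubepos -exprMn maxr_pMr// mulr0.
Qed.

Lemma cubepos_ge_expr3 (R : realType) (x : R) : x ^+ 3 <= cubepos x.
Proof.
have [x0|x0] := leP 0 x; first by rewrite cubepos_pos.
by rewrite cubepos_neg; [rewrite exprS mulr_le0_ge0 ?sqr_ge0|]; rewrite ?ltW.
Qed.

(* As soon as [`|y| <= r], the right-hand side minus the first two terms on the
   left is [(r - 1) ^ 2 * (r + 1/2 - 3/2 y ^ 2) / 2]. *)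
Lemma cubepos_sym_inside (R : realType) (y r : R) : `|y| <= 1 -> 0 <= r ->
  (1 + y) ^+ 3 / 2 + 3 / 4 * (1 + y) ^+ 2 * (r ^+ 2 - 1) + (2 <= r)%R%:R / 2 <=
  (cubepos (y + r) + cubepos (y - r)) / 2.
Proof.
rewrite ler_norml => /andP[y1 y1'] r0.
have [yr|yr] := leP y r.
- rewrite (cubepos_neg (_ : y - r <= 0)); last by lra.
  have [yr'|yr'] := leP (- y) r.
  + rewrite cubepos_pos; last by lra.
    have yy : y ^+ 2 <= r.
      have [y0|y0] := leP 0 y; nra.
    have -> : (y + r) ^+ 3 + 0 = (1 + y) ^+ 3 +
       3 / 2 * (1 + y) ^+ 2 * (r ^+ 2 - 1) +
       (r - 1) ^+ 2 * (r + 1 / 2 - 3 / 2 * y ^+ 2) by field.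
    have [r2|r2] := leP 2 r.
      have : 1 <= (r - 1) ^+ 2 * (r + 1 / 2 - 3 / 2 * y ^+ 2).
        have h1 : 1 <= (r - 1) ^+ 2 by nra.
        have h2 : 1 <= r + 1 / 2 - 3 / 2 * y ^+ 2 by nra.
        nra.
      by rewrite /=; lra.
    have : 0 <= (r - 1) ^+ 2 * (r + 1 / 2 - 3 / 2 * y ^+ 2).
      rewrite mulr_ge0 ?sqr_ge0//.
      have [y0|y0] := leP 0 y; nra.
    by rewrite /=; lra.
  + rewrite cubepos_neg; last by lra.
    have /negbTE -> : ~~ (2 <= r) by rewrite -ltNge; lra.
    rewrite /=.
    have h : 0 <= (1 + y) ^+ 2 by exact: sqr_ge0.
    (* Both positive parts vanish here. Since [r ^ 2 <= y ^ 2], the second factor is at most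
       [(3 * y - 1) * (y + 1)], which is nonpositive for [-1 <= y <= 0]. *)
    have : (1 + y) ^+ 2 * (2 * (1 + y) + 3 * (r ^+ 2 - 1)) <= 0.
      rewrite mulr_ge0_le0//.
      have : r ^+ 2 <= y ^+ 2 by nra.
      nra.
    by rewrite /=; lra.
- rewrite !cubepos_pos; try lra.
  have /negbTE -> : ~~ (2 <= r) by rewrite -ltNge; lra.
    rewrite /=.
  (* Up to positive factors, [h1] and [h2] are the right side minus the left side at [r ^ 2 = 0] and
     at [r ^ 2 = y ^ 2]. *)
  have h1 : 0 <= (1 - y) ^+ 2 * (2 * y + 1) by rewrite mulr_ge0 ?sqr_ge0//; lra.
  have h2 : 0 <= (y - 1) ^+ 2 * (y + 1 / 2 - 3 / 2 * y ^+ 2).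
    rewrite mulr_ge0 ?sqr_ge0//; nra.
  have ry : r ^+ 2 <= y ^+ 2 by nra.
  have -> : (y + r) ^+ 3 + (y - r) ^+ 3 = 2 * y ^+ 3 + 6 * y * r ^+ 2 by ring.
  have r2 : 0 <= r ^+ 2 := sqr_ge0 r.
  move: h1 h2 ry r2; move: (r ^+ 2) => w h1 h2 ry r2.
  (* affine in [w], nonnegative at both ends of [[0, y ^ 2]] *)
  have [k|k] := leP 0 (3 * y - 3 / 4 * (1 + y) ^+ 2); nra.
Qed.

(** The left side is the symmetrised plain cube, and [y + r] is nonnegative, so only the cube of
    [y - r] has to be compared with its positive part. *)
Lemma cubepos_sym_right (R : realType) (y r : R) : 0 <= y -> 0 <= r ->
  y ^+ 3 + 3 * y * r ^+ 2 <= (cubepos (y + r) + cubepos (y - r)) / 2.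
Proof.
move=> y0 r0; rewrite cubepos_pos ?addr_ge0//.
have := cubepos_ge_expr3 (y - r).
suff -> : y ^+ 3 + 3 * y * r ^+ 2 = ((y + r) ^+ 3 + (y - r) ^+ 3) / 2 by lra.
by field.
Qed.

(** [K] is the slope at [g = 1] of the symmetrised cube seen as a function of [g ^ 2]: this function
    lies above its tangent there, strictly so for [g >= 2] when [|y| <= 1]. The slope is
    [3 / 4 * (1 + y) ^ 2], [3 * y] or [0], according to the position of [y] with respect to
    [[-1, 1]]. *)
Lemma cubepos_smoothing1 (R : realType) (y : R) : exists2 K : R, 0 <= K &
  forall g, (cubepos (y + 1) + cubepos (y - 1)) / 2 + K * g ^+ 2 +
    (`|y| <= 1)%R%:R * \1_`[2, 3] g / 2 <=
    (cubepos (y + g) + cubepos (y - g)) / 2 + K.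
Proof.
have symg (g : R) : cubepos (y + `|g|) + cubepos (y - `|g|) =
    cubepos (y + g) + cubepos (y - g).
  by case: ger0P => // _; rewrite opprK addrC.
have [y1|] := leP `|y| 1.
  exists (3 / 4 * (1 + y) ^+ 2) => [|g]; first by rewrite mulr_ge0// sqr_ge0.
  have := cubepos_sym_inside y1 (normr_ge0 g).
  rewrite symg real_normK ?num_real//.
  have -> : cubepos (y + 1) = (1 + y) ^+ 3.
    by rewrite addrC cubepos_pos//; move: y1; rewrite ler_norml; lra.
  have -> : cubepos (y - 1) = 0.
    by rewrite cubepos_neg//; move: y1; rewrite ler_norml; lra.
  have : \1_`[2, 3] g <= (2 <= `|g|)%R%:R :> R.
    rewrite indicE; case: (boolP (g \in _)) => //=.
    by rewrite inE/= in_itv/= => /andP[g2 _]; rewrite (le_trans g2 (ler_norm _)).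
  by rewrite /= mul1r; move: (\1__ _) ((_ <= _)%R%:R) => u v; lra.
rewrite lter_normr => /orP[y1|y1].
  exists (3 * y) => [|g]; first by lra.
  have := cubepos_sym_right (_ : 0 <= y) (normr_ge0 g).
  rewrite symg real_normK ?num_real// => /(_ ltac:(lra)).
  rewrite (@cubepos_pos _ (y + 1)) 1?(@cubepos_pos _ (y - 1)); try lra.
  by rewrite /= !mul0r; lra.
exists 0 => [//|g]; rewrite /= !mul0r !addr0.
rewrite (@cubepos_neg _ (y + 1)) 1?(@cubepos_neg _ (y - 1)); try lra.
by have := cubepos_ge0 (y + g); have := cubepos_ge0 (y - g); lra.
Qed.

(* The quadratic correction [K * (g ^+ 2 - 1)] has Gaussian mean zero. *)
Lemma cubepos_smoothing (R : realType) (y a : R) : 0 < a -> exists2 K : R,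
  0 <= K & forall g, (cubepos (y + a) + cubepos (y - a)) / 2 + K * g ^+ 2 +
    a ^+ 3 / 2 * (`|y| <= a)%R%:R * \1_`[2, 3] g <=
    (cubepos (y + a * g) + cubepos (y - a * g)) / 2 + K.
Proof.
move=> a0; have [K K0 HK] := cubepos_smoothing1 (y / a).
have a3 : 0 <= a ^+ 3 by rewrite exprn_ge0// ltW.
exists (a ^+ 3 * K) => [|g]; first exact: mulr_ge0.
have scale g' : cubepos (y + a * g') = a ^+ 3 * cubepos (y / a + g').
  by rewrite -cubeposM ?ltW// mulrDr mulrCA divff ?mulr1// gt_eqF.
have scaleN g' : cubepos (y - a * g') = a ^+ 3 * cubepos (y / a - g').
  by rewrite -mulrN scale.
have := ler_wpM2l a3 (HK g).
have -> : (`|y / a| <= 1) = (`|y| <= a).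
  by rewrite normrM normfV (gtr0_norm a0) ler_pdivrMr ?mul1r.
rewrite scale scaleN; have := scale 1; have := scaleN 1; rewrite mulr1 => -> ->.
by move: ((_ <= _)%R%:R) (\1__ _) => u v; lra.
Qed.

(** * Gaussian integrals: density, affine changes of variable, second moment, convolution *)

(** The Radon-Nikodym derivative agrees almost everywhere with the density, because the two have the
    same integral over every measurable set. *)
Lemma ge0_integral_normal_prob (R : realType) (m s : R)
    (f : R -> \bar R) :
  measurable_fun [set: R] f -> (forall x, (0 <= f x)%E) ->
  (\int[normal_prob m s]_x f x =
   \int[lebesgue_measure]_x (f x * (normal_pdf m s x)%:E))%E.
Proof.
move=> mf f0; have dom := normal_prob_dominates m s.
rewrite -(Radon_Nikodym_SigmaFinite.change_of_variables dom)//.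
have mpdf : measurable_fun [set: R] (fun x => (normal_pdf m s x)%:E).
  by apply/measurable_EFinP; exact: measurable_normal_pdf.
have iRN := Radon_Nikodym_SigmaFinite.f_integrable dom.
have mRN := measurable_int _ iRN.
apply: ae_eq_integral => //.
- exact: emeasurable_funM.
- exact: emeasurable_funM.
have RNE : ae_eq lebesgue_measure setT (Radon_Nikodym_SigmaFinite.f
    (normal_prob m s) lebesgue_measure) (fun x => (normal_pdf m s x)%:E).
  apply: integral_ae_eq => // E _ mE.
  by rewrite -Radon_Nikodym_SigmaFinite.f_integral.
by apply: filterS RNE => x /= H /H ->.
Qed.

Lemma normal_peakE (R : realType) (s : R) : 0 < s ->
  normal_peak s = s^-1 * normal_peak 1.
Proof.
move=> s0; rewrite /normal_peak expr1n mul1r -mulrnAr sqrtrM ?sqr_ge0//.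
by rewrite sqrtr_sqr gtr0_norm// invfM.
Qed.

Lemma normal_pdf01E (R : realType) (x : R) :
  normal_pdf 0 1 x = normal_peak 1 * expR (- x ^+ 2 / 2).
Proof. by rewrite normal_pdfE ?oner_eq0// /normal_fun subr0 expr1n. Qed.

Lemma normal_pdf_affine (R : realType) (m s x : R) : 0 < s ->
  normal_pdf m s (m + s * x) * s = normal_pdf 0 1 x.
Proof.
move=> s0; rewrite normal_pdf01E normal_pdfE ?gt_eqF// normal_peakE//.
rewrite /normal_fun (addrC m) addrK mulrAC [_ * s]mulrAC mulVf ?gt_eqF// mul1r.
congr (_ * expR _); field; by rewrite gt_eqF.
Qed.

Lemma normal_pdf_gt0 (R : realType) (m s x : R) : s != 0 -> 0 < normal_pdf m s x.
Proof. by move=> s0; rewrite normal_pdfE// mulr_gt0 ?normal_peak_gt0 ?expR_gt0. Qed.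

(** Increasing substitution by [x * s + m] on the right side; [normal_pdf_affine] absorbs the
    Jacobian [s]. *)
Lemma integral_normal_prob_affine (R : realType) (m s : R) (f : R -> R) :
  0 < s -> continuous f -> (forall x, 0 <= f x) ->
  (\int[normal_prob 0 1]_x (f (m + s * x)%R)%:E =
   \int[lebesgue_measure]_x (f x * normal_pdf m s x)%:E)%E.
Proof.
move=> s0 cf f0.
pose F (x : R^o) : R^o := x * s + m.
have F'E : F^`()%classic = cst s.
  apply/funext => x; rewrite /F derive1E deriveD// deriveM// !derive_cst.
  by rewrite addr0 scaler0 add0r derive_id scaler1.
have dF (x : R^o) : derivable F x 1 by [].
have cF : continuous F.
  move=> x; exact/differentiable_continuous/derivable1_diffP/dF.
have mf : measurable_fun [set: R] f by exact: continuous_measurable_fun.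
rewrite ge0_integral_normal_prob//; last 2 first.
- apply/measurable_EFinP; apply: (measurableT_comp mf).
  by apply: measurable_funD => //; exact: measurable_funM.
- by move=> x; rewrite lee_fin.
rewrite [RHS](@increasing_ge0_integration_by_substitutionT _ F).
- apply: eq_integral => x _.
  by rewrite -(normal_pdf_affine m x s0) F'E -EFinM mulrA addrC (mulrC s).
- by move=> x y xy; rewrite /F ltrD2r ltr_pM2r.
- by rewrite F'E => ?; exact: cvg_cst.
- by rewrite F'E; exact: is_cvg_cst.
- by rewrite F'E; exact: is_cvg_cst.
- exact: dF.
- exact: (cvg_comp _ _ (gt0_cvgMlNy s0 cvg_id) (cvg_addrr_Ny _)).
- exact: (cvg_comp _ _ (gt0_cvgMly s0 cvg_id) (cvg_addrr _)).
- move=> x; apply: cvgM; first exact: cf.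
  by apply: continuous_normal_pdf; rewrite gt_eqF.
- by move=> x; rewrite mulr_ge0// normal_pdf_ge0.
Qed.

Lemma integral_normal_prob_opp (R : realType) (f : R -> \bar R) :
  measurable_fun [set: R] f -> (forall x, (0 <= f x)%E) ->
  (\int[normal_prob 0 1]_x f (- x)%R = \int[normal_prob 0 1]_x f x)%E.
Proof.
move=> mf f0.
have mpdf : measurable_fun [set: R] (fun x : R => (normal_pdf 0 1 x)%:E).
  by apply/measurable_EFinP; exact: measurable_normal_pdf.
have pdfN (x : R) : normal_pdf 0 1 (- x) = normal_pdf 0 1 x.
  by rewrite !normal_pdf01E sqrrN.
rewrite !ge0_integral_normal_prob//; last first.
  by apply: measurableT_comp => //; exact: oppr_measurable.
pose F (x : R) := (f x * (normal_pdf 0 1 x)%:E)%E.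
transitivity (\int[lebesgue_measure]_x (F \o -%R) x)%E.
  by apply: eq_integral => x _; rewrite /F/= pdfN.
rewrite -(preimage_setT (-%R : R -> measurableTypeR R)).
rewrite -ge0_integral_pushforward//=.
- by apply: eq_measure_integral => //= A mA _; exact: lebesgue_measureN.
- exact: emeasurable_funM.
- by move=> x _; rewrite mule_ge0// lee_fin normal_pdf_ge0.
Qed.

Lemma integral_normal_prob_cst (R : realType) (c : R) :
  (\int[normal_prob (0 : R) 1]_x c%:E)%E = c%:E.
Proof.
rewrite integral_cst//= -[RHS]mule1; congr (_ * _)%E.
exact: (@probability_setT _ _ _ (normal_prob (0 : R) 1)).
Qed.

(** The integrand times the standard density is [nu^-1] times the centred normal density of standard
    deviation [nu^-1]. *)
Lemma integral_normal_prob_gauss (R : realType) (nu : R) : 0 < nu ->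
  (\int[normal_prob 0 1]_x (expR (- (nu ^+ 2 - 1) * x ^+ 2 / 2))%:E = nu^-1%:E)%E.
Proof.
move=> nu0; rewrite ge0_integral_normal_prob//; last first.
  apply/measurable_EFinP; apply: measurableT_comp => //.
  by do 2 apply: measurable_funM => //.
have nuV : nu^-1 != 0 by rewrite invr_eq0 gt_eqF.
under eq_integral => x _.
  rewrite -EFinM [X in X%:E](_ : _ = nu^-1 * normal_pdf 0 nu^-1 x); first over.
  rewrite normal_pdf01E normal_pdfE// (@normal_peakE _ nu^-1) ?invr_gt0// invrK.
  rewrite mulrCA -expRD -[nu * _ * _]mulrA mulKf ?gt_eqF//.
  by congr (_ * expR _); rewrite subr0; field; rewrite gt_eqF.
under eq_integral do rewrite EFinM.
rewrite ge0_integralZl//; first by rewrite integral_normal_pdf mule1.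
- by apply/measurable_EFinP; exact: measurable_normal_pdf.
- by move=> x _; rewrite lee_fin normal_pdf_ge0.
- by rewrite lee_fin invr_ge0 ltW.
Qed.

(* From [1 <= exp (- u) + u] for [u = (nu ^ 2 - 1) * x ^ 2 / 2], letting [nu]
   tend to [1]. *)
Lemma normal_prob_second_moment_ge1 (R : realType) :
  (1 <= \int[normal_prob 0 1]_x ((x : R) ^+ 2)%:E)%E.
Proof.
have msq : measurable_fun [set: R] (fun x : R => (x ^+ 2)%:E).
  by apply/measurable_EFinP; exact: exprn_measurable.
set M := (\int[_]_x _)%E.
have M0 : (0 <= M)%E by apply: integral_ge0 => x _; rewrite lee_fin sqr_ge0.
have key (nu : R) : 1 < nu -> (1 <= nu^-1%:E + ((nu ^+ 2 - 1) / 2)%:E * M)%E.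
  move=> nu1.
  have nu2 : 0 <= (nu ^+ 2 - 1) / 2 by nra.
  rewrite -integral_normal_prob_gauss; last by lra.
  have mexp : measurable_fun [set: R]
      (fun x : R => (expR (- (nu ^+ 2 - 1) * x ^+ 2 / 2))%:E).
    apply/measurable_EFinP; apply: measurableT_comp => //.
    by do 2 apply: measurable_funM => //.
  have msq' : measurable_fun [set: R]
      (fun x : R => ((nu ^+ 2 - 1) / 2)%:E * (x ^+ 2)%:E)%E.
    by apply/measurable_EFinP; apply: measurable_funM.
  have sq0 (x : R) : (0 <= (x ^+ 2)%:E)%E by rewrite lee_fin sqr_ge0.
  have sq0' (x : R) : (0 <= ((nu ^+ 2 - 1) / 2)%:E * (x ^+ 2)%:E)%E.
    by rewrite mule_ge0// lee_fin.
  rewrite -ge0_integralZl// -ge0_integralD//.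
  rewrite -[leLHS](integral_normal_prob_cst (1 : R)).
  apply: ge0_le_integral => //.
  - exact: emeasurable_funD.
  - move=> x _; rewrite -EFinM -EFinD lee_fin.
    by have := expR_ge1Dx (- (nu ^+ 2 - 1) * x ^+ 2 / 2); lra.
rewrite leNgt; apply/negP => M1.
have Mfin : M \is a fin_num by rewrite ge0_fin_numE// (lt_trans M1) ?ltry.
move: M1 M0 key; rewrite -(fineK Mfin) !lte_fin !lee_fin.
move: (fine M) => m m1 m0 key.
(* Multiplied by [nu], the bound [key nu] forces [nu * (nu + 1) * m / 2] to be at least [1]. As
   [m < 1], this fails for [nu] close to [1], and this [nu] is close enough. *)
pose nu := 1 + (1 - m) / 4.
have nu1 : 1 < nu by rewrite /nu; lra.
have := key nu nu1; rewrite -EFinM -EFinD lee_fin.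
rewrite -(ler_pM2l (_ : 0 < nu)); last by lra.
rewrite mulr1 mulrDr divff; last by rewrite gt_eqF//; lra.
have -> : nu * ((nu ^+ 2 - 1) / 2 * m) = (nu - 1) * (nu * (nu + 1) * m / 2).
  by field.
have : nu * (nu + 1) * m / 2 < 1 by rewrite /nu; nra.
have : 0 < nu - 1 by lra.
move: (nu * (nu + 1) * m / 2) => w; nra.
Qed.

(* Completing the square in [g]. *)
Lemma normal_pdf_mul (R : realType) (y a s g u : R) : 0 < a -> 0 < s ->
  let sigma := Num.sqrt (a ^+ 2 + s ^+ 2) in
  normal_pdf (y + a * g) s u * normal_pdf 0 1 g =
  normal_pdf y sigma u *
  normal_pdf (a * (u - y) / (a ^+ 2 + s ^+ 2)) (s / sigma) g.
Proof.
move=> a0 s0 sigma.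
have d0 : 0 < a ^+ 2 + s ^+ 2 by rewrite addr_gt0// exprn_gt0.
have sigma0 : 0 < sigma by rewrite sqrtr_gt0.
have sigma2 : sigma ^+ 2 = a ^+ 2 + s ^+ 2 by rewrite sqr_sqrtr// ltW.
have ss0 : 0 < s / sigma by rewrite divr_gt0.
rewrite !normal_pdfE ?oner_eq0 ?gt_eqF//.
rewrite (normal_peakE s0) (normal_peakE sigma0) (normal_peakE ss0) /normal_fun.
rewrite expr1n subr0 expr_div_n sigma2.
rewrite mulrACA [RHS]mulrACA -!expRD; congr (_ * expR _).
  by field; rewrite !gt_eqF.
by field; rewrite !gt_eqF//; lra.
Qed.

(** Write the inner integral with its density in the variable [u = y + a * g + s * h] and exchange
    the integrals. By [normal_pdf_mul], what is left in [g] is a normal density, of integral [1]. *)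
Lemma normal_prob_convolution_pos (R : realType) (y a s : R) (f : R -> R) :
  0 < a -> 0 < s -> continuous f -> (forall x, 0 <= f x) ->
  (\int[normal_prob 0 1]_g \int[normal_prob 0 1]_h (f (y + a * g + s * h)%R)%:E =
   \int[normal_prob 0 1]_g (f (y + Num.sqrt (a ^+ 2 + s ^+ 2) * g)%R)%:E)%E.
Proof.
move=> a0 s0 cf f0; set sigma := Num.sqrt _.
have d0 : 0 < a ^+ 2 + s ^+ 2 by rewrite addr_gt0// exprn_gt0.
have sigma0 : 0 < sigma by rewrite sqrtr_gt0.
have mf : measurable_fun [set: R] f by exact: continuous_measurable_fun.
pose k (z : R * R) : R := f z.2 * normal_pdf (y + a * z.1) s z.2.
have k0 z : 0 <= k z by rewrite mulr_ge0 ?normal_pdf_ge0.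
have mk : measurable_fun [set: measurableTypeR R * measurableTypeR R] k.
  apply: measurable_funM; first exact: measurableT_comp.
  rewrite /normal_pdf gt_eqF//.
  apply: measurable_funM => //; apply: measurableT_comp => //.
  apply: measurable_funM => //; apply: measurableT_comp => //.
  apply: measurable_funX; apply: measurable_funB => //.
  by apply: measurable_funD => //; apply: measurable_funM.
have mkE := (measurable_EFinP _ _).2 mk.
under eq_integral do rewrite integral_normal_prob_affine//.
rewrite [LHS]ge0_integral_normal_prob; last 2 first.
- have kE0 z : (0 <= (EFin \o k) z)%E by rewrite lee_fin.
  exact: (measurable_fun_fubini_tonelli_F
    (m2 := @lebesgue_measure R : {sigma_finite_measure set _ -> \bar R}) _ mkE kE0).
- by move=> g; apply: integral_ge0 => u _; rewrite lee_fin (k0 (g, u)).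
have mk1 : measurable_fun [set: measurableTypeR R * measurableTypeR R]
    (fun z => (k z * normal_pdf 0 1 z.1)%:E).
  apply/measurable_EFinP; apply: measurable_funM => //.
  by apply: measurableT_comp => //; exact: measurable_normal_pdf.
transitivity (\int[lebesgue_measure]_g \int[lebesgue_measure]_u
    (k (g, u) * normal_pdf 0 1 g)%:E)%E.
  apply: eq_integral => g _; rewrite -ge0_integralZr//.
  - apply/measurable_EFinP; apply: measurable_funM => //.
    exact: measurable_normal_pdf.
  - by move=> u _; rewrite lee_fin (k0 (g, u)).
  - by rewrite lee_fin normal_pdf_ge0.
rewrite (@fubini_tonelli _ _ _ _ _ lebesgue_measure lebesgue_measure
  _ mk1); last first.
  by move=> z; rewrite lee_fin mulr_ge0 ?normal_pdf_ge0.
rewrite integral_normal_prob_affine//; apply: eq_integral => u _ /=.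
under eq_integral => g _ do
  rewrite /k /= -mulrA normal_pdf_mul// mulrA EFinM.
rewrite ge0_integralZl//.
- by rewrite integral_normal_pdf mule1.
- by apply/measurable_EFinP; exact: measurable_normal_pdf.
- by move=> x _; rewrite lee_fin normal_pdf_ge0.
- by rewrite lee_fin mulr_ge0 ?normal_pdf_ge0.
Qed.

(** * Gaussian smoothing of [cubepos] *)

Lemma continuous_cubepos (R : realType) : continuous (@cubepos R).
Proof.
move=> x.
apply: (@continuous_comp _ _ _ (fun x : R => Num.max x 0) (fun x => x ^+ 3)).
  have h1 : {for x, continuous (fun x : R => x : R^o)} by exact: cvg_id.
  have h2 : {for x, continuous (fun _ : R => 0 : R^o)} by exact: cvg_cst.
  exact: (continuous_max h1 h2).
exact: exprn_continuous.
Qed.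

Lemma measurable_cubepos (R : realType) : measurable_fun [set: R] (@cubepos R).
Proof. apply: continuous_measurable_fun; exact: continuous_cubepos. Qed.

Lemma measurable_cubepos_affine (R : realType) (y s : R) :
  measurable_fun [set: R] (fun g : R => (cubepos (y + s * g))%:E).
Proof.
apply/measurable_EFinP; apply: (measurableT_comp (@measurable_cubepos R)).
by apply: measurable_funD => //; exact: measurable_funM.
Qed.

(** Cube [x / 3 <= expR (x / 3)]. The exponential bound serves to show that Gaussian means of
    [cubepos] are finite. *)
Lemma cubepos_le_expR (R : realType) (x : R) : cubepos x <= 27 * expR x.
Proof.
have [x0|x0] := leP x 0; first by rewrite cubepos_neg// mulr_ge0// expR_ge0.
rewrite cubepos_pos; last exact: ltW.
have e : x / 3 <= expR (x / 3) by have := expR_ge1Dx (x / 3); lra.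
have -> : expR x = expR (x / 3) ^+ 3.
  by rewrite -expRM_natl; congr expR; field.
have -> : x ^+ 3 = 27 * (x / 3) ^+ 3 by field.
by rewrite ler_pM2l// lerXn2r// nnegrE ?expR_ge0// divr_ge0// ltW.
Qed.

(** After the exponential bound, [expR (s * x)] times the standard density is [expR (s ^ 2 / 2)]
    times the normal density of mean [s]. *)
Lemma integral_cubepos_lty (R : realType) (y s : R) :
  (\int[normal_prob 0 1]_g (cubepos (y + s * g))%:E < +oo)%E.
Proof.
have mpdf : measurable_fun [set: R] (fun x : R => (normal_pdf s 1 x)%:E).
  by apply/measurable_EFinP; exact: measurable_normal_pdf.
rewrite ge0_integral_normal_prob//; last 2 first.
- exact: measurable_cubepos_affine.
- by move=> x; rewrite lee_fin cubepos_ge0.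
apply: (@le_lt_trans _ _ (\int[lebesgue_measure]_x
    ((27 * expR (y + s ^+ 2 / 2))%:E * (normal_pdf s 1 x)%:E))%E).
  apply: ge0_le_integral => //.
  - by move=> x _; rewrite mule_ge0// lee_fin ?cubepos_ge0 ?normal_pdf_ge0.
  - apply: emeasurable_funM; first exact: measurable_cubepos_affine.
    by apply/measurable_EFinP; exact: measurable_normal_pdf.
  - exact: emeasurable_funM.
  move=> x _; rewrite -!EFinM lee_fin.
  apply: (@le_trans _ _ (27 * expR (y + s * x) * normal_pdf 0 1 x)).
    by rewrite ler_wpM2r ?normal_pdf_ge0 ?cubepos_le_expR.
  rewrite normal_pdf01E normal_pdfE ?oner_eq0// /normal_fun expr1n.
  rewrite -!mulrA ler_pM2l// mulrCA [leRHS]mulrCA -!expRD.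
  rewrite le_eqVlt; apply/orP; left; apply/eqP.
  by congr (_ * expR _); field.
rewrite ge0_integralZl//; first by rewrite integral_normal_pdf mule1 ltry.
by move=> x _; rewrite lee_fin normal_pdf_ge0.
Qed.

(* [tau] is the variance of the Gaussian smoothing. *)
Definition smooth_cube {R : realType} (tau y : R) : R :=
  fine (\int[normal_prob 0 1]_g (cubepos (y + Num.sqrt tau * g))%:E).

Lemma smooth_cubeE (R : realType) (tau y : R) :
  (smooth_cube tau y)%:E =
  (\int[normal_prob 0 1]_g (cubepos (y + Num.sqrt tau * g))%:E)%E.
Proof.
rewrite fineK// ge0_fin_numE ?integral_cubepos_lty//.
by apply: integral_ge0 => x _; rewrite lee_fin cubepos_ge0.
Qed.

Lemma smooth_cube0 (R : realType) (y : R) : smooth_cube 0 y = cubepos y.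
Proof.
rewrite /smooth_cube sqrtr0; under eq_integral do rewrite mul0r addr0.
by rewrite integral_normal_prob_cst.
Qed.

(** The variances add up. The convolution formula covers [tau > 0]; for [tau = 0] the outer
    integrand is constant. *)
Lemma smooth_cube_convolution (R : realType) (y a tau : R) : 0 < a -> 0 <= tau ->
  (\int[normal_prob 0 1]_h \int[normal_prob 0 1]_g
     (cubepos (y + Num.sqrt tau * h + a * g)%R)%:E)%E =
  (smooth_cube (tau + a ^+ 2) y)%:E.
Proof.
move=> a0; rewrite le_eqVlt => /predU1P[<-|tau0].
  rewrite sqrtr0; under eq_integral do under eq_integral do rewrite mul0r addr0.
  have E := smooth_cubeE (a ^+ 2) y; rewrite sqrtr_sqr gtr0_norm// in E.
  by rewrite -E integral_normal_prob_cst add0r.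
rewrite normal_prob_convolution_pos ?sqrtr_gt0//.
- by rewrite sqr_sqrtr ?ltW// -smooth_cubeE.
- exact: continuous_cubepos.
- by move=> x; exact: cubepos_ge0.
Qed.

(** * Gain from the replacement of a single sign by a Gaussian *)

(** Gaussian mean of the indicator term of [cubepos_smoothing] when [|y| <= a], without its factor
    [a ^ 3]. *)
Definition gain_const (R : realType) : R :=
  fine (normal_prob (0 : R) 1 `[2, 3]%classic) / 2.

Lemma normal_prob_fin_num (R : realType) (A : set R) :
  measurable A -> normal_prob (0 : R) 1 A \is a fin_num.
Proof. exact: (fin_num_measure (normal_prob (0 : R) 1)). Qed.

(** Integrate [cubepos_smoothing] over a standard Gaussian [g]. By symmetry, [y + a * g] and
    [y - a * g] contribute equally. As [K >= 0] and the second moment is at least [1], the terms in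
    [K] can be cancelled. *)
Lemma smooth_cube_gain1 (R : realType) (y a : R) : 0 < a ->
  (cubepos (y + a) + cubepos (y - a)) / 2 +
    gain_const R * a ^+ 3 * (`|y| <= a)%R%:R <= smooth_cube (a ^+ 2) y.
Proof.
move=> a0; have [K K0 HK] := cubepos_smoothing y a0.
have scE := smooth_cubeE (a ^+ 2) y; rewrite sqrtr_sqr gtr0_norm// in scE.
have scNE : (\int[normal_prob 0 1]_g (cubepos (y - a * g))%:E)%E =
    (smooth_cube (a ^+ 2) y)%:E.
  rewrite scE -[RHS]integral_normal_prob_opp.
  - by apply: eq_integral => g _; rewrite mulrN.
  - exact: measurable_cubepos_affine.
  - by move=> x; rewrite lee_fin cubepos_ge0.
have mN : measurable_fun [set: R] (fun g : R => (cubepos (y - a * g))%:E).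
  under eq_fun do rewrite -mulNr; exact: measurable_cubepos_affine.
have cp0 (x : R) : (0 <= (cubepos x)%:E)%E by rewrite lee_fin cubepos_ge0.
set A := (cubepos (y + a) + cubepos (y - a)) / 2 in HK *.
have A0 : 0 <= A by rewrite divr_ge0// addr_ge0 ?cubepos_ge0.
set B := a ^+ 3 / 2 * (`|y| <= a)%R%:R in HK.
have B0 : 0 <= B by rewrite mulr_ge0 ?ler0n// divr_ge0// exprn_ge0// ltW.
(* The inequality is doubled and [K] is kept on both sides, so that every integrand is a sum of
   nonnegative terms. *)
have up : (\int[normal_prob (0 : R) 1]_g
    ((cubepos (y + a * g))%:E + (cubepos (y - a * g))%:E + (2 * K)%:E) =
    (2 * smooth_cube (a ^+ 2) y + 2 * K)%:E)%E.
  rewrite ge0_integralD//; last 3 first.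
  - by move=> x _; rewrite adde_ge0.
  - by apply: emeasurable_funD => //; exact: measurable_cubepos_affine.
  - by move=> x _; rewrite lee_fin mulr_ge0.
  rewrite ge0_integralD//; last exact: measurable_cubepos_affine.
  by rewrite -scE scNE integral_normal_prob_cst -!EFinD; congr EFin; ring.
have m2 : measurable_fun [set: R] (fun g : R => (g ^+ 2)%:E).
  by apply/measurable_EFinP; exact: exprn_measurable.
have mK2 : measurable_fun [set: R] (fun g : R => (2 * K)%:E * (g ^+ 2)%:E)%E.
  exact: emeasurable_funM.
have mI : measurable_fun [set: R] (fun g : R => (\1_`[2, 3] g : R)%:E).
  by apply/measurable_EFinP; exact: measurable_indic.
have mBI : measurable_fun [set: R] (fun g : R => (2 * B)%:E * (\1_`[2, 3] g)%:E)%E.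
  exact: emeasurable_funM.
have mA2 : measurable_fun [set: R]
    (fun g : R => (2 * A)%:E + (2 * K)%:E * (g ^+ 2)%:E)%E.
  exact: emeasurable_funD.
have p2 (g : R) : (0 <= (g ^+ 2)%:E)%E by rewrite lee_fin sqr_ge0.
have pA : (0 <= (2 * A)%:E)%E by rewrite lee_fin mulr_ge0.
have pK : (0 <= (2 * K)%:E)%E by rewrite lee_fin mulr_ge0.
have pB : (0 <= (2 * B)%:E)%E by rewrite lee_fin mulr_ge0.
have pI (g : R) : (0 <= (\1_`[2, 3] g : R)%:E)%E by rewrite lee_fin.
have pK2 (g : R) : (0 <= (2 * K)%:E * (g ^+ 2)%:E)%E by exact: mule_ge0.
have pBI (g : R) : (0 <= (2 * B)%:E * (\1_`[2, 3] g)%:E)%E by exact: mule_ge0.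
have pA2 (g : R) : (0 <= (2 * A)%:E + (2 * K)%:E * (g ^+ 2)%:E)%E.
  exact: adde_ge0.
have low : (((2 * A + 2 * K)%:E +
   (2 * B * fine (normal_prob (0 : R) 1 `[2, 3]%classic))%:E) <=
   \int[normal_prob (0 : R) 1]_g ((2 * A)%:E + (2 * K)%:E * (g ^+ 2)%:E
   + (2 * B)%:E * (\1_`[2, 3] g)%:E))%E.
  rewrite !ge0_integralD// integral_normal_prob_cst !ge0_integralZl//.
  rewrite integral_indic// setIT.
  rewrite EFinD EFinM [(2 * B * _)%:E]EFinM fineK; last exact: normal_prob_fin_num.
  rewrite leeD2r// leeD2l// -[leLHS]mule1 lee_wpmul2l//.
  exact: normal_prob_second_moment_ge1.
have le : (\int[normal_prob (0 : R) 1]_g ((2 * A)%:E + (2 * K)%:E * (g ^+ 2)%:E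
   + (2 * B)%:E * (\1_`[2, 3] g)%:E) <= \int[normal_prob (0 : R) 1]_g
   ((cubepos (y + a * g))%:E + (cubepos (y - a * g))%:E + (2 * K)%:E))%E.
  apply: ge0_le_integral => //.
  - by move=> x _; exact: adde_ge0.
  - exact: emeasurable_funD.
  - apply: emeasurable_funD => //; apply: emeasurable_funD => //.
    exact: measurable_cubepos_affine.
  - move=> x _; rewrite -!EFinM -!EFinD lee_fin.
    by have := HK x; rewrite -/A -/B; lra.
have := le_trans low (le_trans le _); rewrite up => /(_ _ (lexx _)).
rewrite -EFinD lee_fin.
suff -> : gain_const R * a ^+ 3 * (`|y| <= a)%R%:R =
  B * fine (normal_prob (0 : R) 1 `[2, 3]%classic) by lra.
by rewrite /gain_const /B; ring.
Qed.

Lemma measurable_affine_ball (R : realType) (y s a : R) :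
  measurable ([set h | `|y + s * h| <= a] : set R).
Proof.
have mf : measurable_fun [set: R] (fun h : R => `|y + s * h|).
  apply: measurableT_comp => //.
  by apply: measurable_funD => //; exact: measurable_funM.
have := mf measurableT `]-oo, a]%classic (measurable_itv _).
by rewrite setTI; congr measurable; apply/seteqP; split => x /=; rewrite in_itv.
Qed.

(* [Num.sqrt tau * h] is the sum of the Gaussians already in place. *)
Lemma smooth_cube_step (R : realType) (tau a y : R) : 0 <= tau -> 0 <= a ->
  (smooth_cube tau (y + a) + smooth_cube tau (y - a)) / 2 +
    gain_const R * a ^+ 3 *
    fine (normal_prob (0 : R) 1 [set h | `|y + Num.sqrt tau * h| <= a]) <=
  smooth_cube (tau + a ^+ 2) y.
Proof.
move=> tau0; rewrite le_eqVlt => /predU1P[<-|a0].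
  by rewrite !expr0n/= !addr0 subr0 mulr0 mul0r addr0; lra.
set C := [set h | _].
have mC : measurable (C : set R) by exact: measurable_affine_ball.
have c0 : 0 <= gain_const R by rewrite divr_ge0// fine_ge0.
have ca0 : 0 <= gain_const R * a ^+ 3 by rewrite mulr_ge0// exprn_ge0// ltW.
pose F (z h : R) : \bar R := (cubepos (z + Num.sqrt tau * h))%:E.
have mF z : measurable_fun [set: R] (F z) by exact: measurable_cubepos_affine.
have cp0 (x : R) : (0 <= (cubepos x)%:E)%E by rewrite lee_fin cubepos_ge0.
(* Split the variance: for fixed [h], the inner integral is [smooth_cube (a ^ 2)] at
   [y + Num.sqrt tau * h], where [smooth_cube_gain1] applies. *)
rewrite -lee_fin -(smooth_cube_convolution y a0 tau0).
under eq_integral => h _.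
  have E := smooth_cubeE (a ^+ 2) (y + Num.sqrt tau * h).
  rewrite sqrtr_sqr gtr0_norm// in E; rewrite -E; over.
have msc : measurable_fun [set: R]
    (fun h : R => (smooth_cube (a ^+ 2) (y + Num.sqrt tau * h))%:E).
  pose k (z : R * R) := cubepos (y + Num.sqrt tau * z.1 + a * z.2).
  have mk : measurable_fun [set: measurableTypeR R * measurableTypeR R] (EFin \o k).
    apply/measurable_EFinP; apply: (measurableT_comp (@measurable_cubepos R)).
    apply: measurable_funD; last exact: measurable_funM.
    by apply: measurable_funD => //; exact: measurable_funM.
  have k0 z : (0 <= (EFin \o k) z)%E by rewrite lee_fin cubepos_ge0.
  under eq_fun do rewrite smooth_cubeE sqrtr_sqr gtr0_norm//.
  exact: (measurable_fun_fubini_tonelli_F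
    (m2 := normal_prob (0 : R) 1 : {sigma_finite_measure set _ -> \bar R}) _ mk k0).
have mI : measurable_fun [set: R] (fun h : R => (\1_C h : R)%:E).
  by apply/measurable_EFinP; exact: measurable_indic.
have mcI : measurable_fun [set: R]
    (fun h : R => (gain_const R * a ^+ 3)%:E * (\1_C h)%:E)%E.
  exact: emeasurable_funM.
have mFF : measurable_fun [set: R] (fun h => F (y + a)%R h + F (y - a)%R h)%E.
  exact: emeasurable_funD.
have mhFF : measurable_fun [set: R]
    (fun h => (1 / 2)%:E * (F (y + a)%R h + F (y - a)%R h))%E.
  exact: emeasurable_funM.
have h0 : (0 <= (1 / 2 : R)%:E)%E by rewrite lee_fin; lra.
have cE0 : (0 <= (gain_const R * a ^+ 3)%:E)%E by rewrite lee_fin.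
have F0 z h : (0 <= F z h)%E by exact: cp0.
have FF0 h : (0 <= F (y + a)%R h + F (y - a)%R h)%E by exact: adde_ge0.
have hFF0 h : (0 <= (1 / 2)%:E * (F (y + a)%R h + F (y - a)%R h))%E.
  exact: mule_ge0.
have I0 (h : R) : (0 <= (\1_C h : R)%:E)%E by rewrite lee_fin.
have cI0 (h : R) : (0 <= (gain_const R * a ^+ 3)%:E * (\1_C h)%:E)%E.
  exact: mule_ge0.
apply: (@le_trans _ _ (\int[normal_prob (0 : R) 1]_h
   ((1 / 2)%:E * (F (y + a)%R h + F (y - a)%R h) +
    (gain_const R * a ^+ 3)%:E * (\1_C h)%:E)))%E.
  have [mF1 mF2] := (mF (y + a), mF (y - a)).
  rewrite ge0_integralD// !ge0_integralZl// ge0_integralD//.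
  rewrite integral_indic// setIT /F -!smooth_cubeE.
  rewrite -[X in (_ <= _ + _ * X)%E](fineK (normal_prob_fin_num mC)).
  rewrite lee_fin.
  by rewrite le_eqVlt; apply/orP; left; apply/eqP; congr (_ + _); field.
apply: ge0_le_integral => //.
- by move=> h _; exact: adde_ge0.
- exact: emeasurable_funD.
- move=> h _; rewrite lee_fin.
  have := smooth_cube_gain1 (y + Num.sqrt tau * h) a0.
  rewrite indicE; have -> : (h \in C) = (`|y + Num.sqrt tau * h| <= a).
    by apply/idP/idP => [|?]; rewrite inE.
  rewrite [y + a + _]addrAC [y - a + _]addrAC.
  by move: (_ %:R) => u; lra.
Qed.

(** * Lower bounds for Gaussian probabilities of small balls *)

(** The standard density decreases with [|x|], so on [[u, v]] it is at least its value at [K]. *)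
Lemma normal_prob_ge_itv (R : realType) (A : set R) (u v K : R) :
  measurable A -> u <= v -> `[u, v]%classic `<=` A ->
  (forall h, u <= h <= v -> `|h| <= K) ->
  normal_pdf 0 1 K * (v - u) <= fine (normal_prob (0 : R) 1 A).
Proof.
move=> mA uv IA HK.
rewrite -lee_fin fineK; last exact: normal_prob_fin_num.
have mpdf : measurable_fun [set: R] (fun x : R => (normal_pdf 0 1 x)%:E).
  by apply/measurable_EFinP; exact: measurable_normal_pdf.
apply: (@le_trans _ _
  (\int[lebesgue_measure]_(x in `[u, v]) (normal_pdf 0 1 x)%:E)%E).
  have -> : (normal_pdf 0 1 K * (v - u))%:E =
     (\int[lebesgue_measure]_(x in `[u, v]) (cst (normal_pdf 0 1 K)%:E x))%E.
    rewrite integral_cst//= lebesgue_measure_itv/= lte_fin.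
    move: uv; rewrite le_eqVlt => /predU1P[->|->]; last by rewrite -EFinB -EFinM.
    by rewrite ltxx subrr mulr0 mule0.
  apply: ge0_le_integral => //.
  - by move=> x _; rewrite lee_fin normal_pdf_ge0.
  - exact: measurable_funTS.
  - move=> x /=; rewrite in_itv/= => /HK xK; rewrite lee_fin !normal_pdf01E.
    rewrite ler_pM2l ?normal_peak_gt0 ?oner_eq0// ler_expR !mulNr lerN2.
    rewrite ler_pM2r// -(real_normK (num_real x)) lerXn2r// nnegrE.
    exact: le_trans xK.
apply: ge0_subset_integral => //.
- exact: measurable_funTS.
- by move=> x _; rewrite lee_fin normal_pdf_ge0.
Qed.

Lemma gain_const_gt0 (R : realType) : 0 < gain_const R.
Proof.
rewrite divr_gt0//.
apply: lt_le_trans (@normal_prob_ge_itv _ _ 2 3 3 _ _ _ _) => //.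
- by rewrite mulr_gt0 ?normal_pdf_gt0 ?oner_eq0//; lra.
- by lra.
- by move=> h /andP[h2 h3]; rewrite ger0_norm//; lra.
Qed.

(** For [|y| >= 2] the left side is nonpositive. Otherwise the event contains an interval of length
    [2 * a / Num.sqrt tau >= 2 * a], whose points are at most [(2 + 1) * 3 = 9] in absolute value
    because [Num.sqrt tau >= 1 / 3]. The factor is quadratic in [y] so that [sign_mean_sqr] can
    average it exactly. *)
Lemma small_ball_smooth (R : realType) (tau a y : R) : 1 / 8 <= tau <= 1 ->
  0 <= a <= 1 ->
  2 * normal_pdf 0 1 9 * a * (1 - y ^+ 2 / 4) <=
  fine (normal_prob (0 : R) 1 [set h | `|y + Num.sqrt tau * h| <= a]).
Proof.
move=> /andP[t8 t1] /andP[a0 a1].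
set A := [set h | _].
have mA : measurable (A : set R) by exact: measurable_affine_ball.
have p9 : 0 < normal_pdf (0 : R) 1 9 by rewrite normal_pdf_gt0 ?oner_eq0.
have A0 : 0 <= fine (normal_prob (0 : R) 1 A) by rewrite fine_ge0.
have [y2|y2] := leP 2 `|y|.
  have : 2 ^+ 2 <= `|y| ^+ 2 by rewrite lerXn2r// nnegrE.
  rewrite real_normK ?num_real// => y4.
  apply: le_trans A0; apply: mulr_ge0_le0; last by lra.
  by rewrite !mulr_ge0// ltW.
set s := Num.sqrt tau in A mA A0 *.
have s1 : s <= 1 by rewrite -sqrtr1 ler_wsqrtr.
have s3 : 1 / 3 <= s.
  have p3 : 0 <= 1 / 3 :> R by lra.
  rewrite -(ger0_norm p3) -sqrtr_sqr ler_wsqrtr//.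
  by apply: le_trans t8; lra.
have s0 : 0 < s by lra.
apply: le_trans
  (@normal_prob_ge_itv _ A ((- y - a) / s) ((- y + a) / s) 9 mA _ _ _).
- have -> : (- y + a) / s - (- y - a) / s = 2 * a / s.
    by field; rewrite gt_eqF.
  apply: (@le_trans _ _ (2 * normal_pdf 0 1 9 * a)).
    apply: ler_piMr; last by have := sqr_ge0 y; lra.
    by rewrite !mulr_ge0// ltW.
  rewrite -mulrA mulrCA ler_pM2l// -mulrA ler_pM2l// ler_peMr//.
  by rewrite invf_ge1.
- by rewrite ler_pM2r ?invr_gt0//; lra.
- move=> h /=; rewrite in_itv/= ler_pdivrMr// ler_pdivlMr// /A/= ler_norml.
  move=> /andP[h1 h2].
  by rewrite mulrC; apply/andP; split; lra.
- move=> h; rewrite ler_pdivrMr// ler_pdivlMr// => /andP[h1 h2].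
  move: y2; rewrite ltr_norml => /andP[y1 y2].
  rewrite ler_norml; apply/andP; split; nra.
Qed.

(** Without smoothing the condition does not depend on [h], so the probability is [0] or [1].
    Averaged over [y], the quadratic bound is Chebyshev's inequality. *)
Lemma small_ball_dirac (R : realType) (a y : R) : 0 < a ->
  1 - y ^+ 2 / a ^+ 2 <=
  fine (normal_prob (0 : R) 1 [set h | `|y + Num.sqrt 0 * h| <= a]).
Proof.
move=> a0; have [ya|ya] := leP `|y| a.
  have -> : [set h : R | `|y + Num.sqrt 0 * h| <= a] = setT.
    by apply/seteqP; split => // h _ /=; rewrite sqrtr0 mul0r addr0.
  have -> : normal_prob (0 : R) 1 setT = 1%E.
    exact: (@probability_setT _ _ _ (normal_prob (0 : R) 1)).
  by rewrite /= gerBl divr_ge0 ?sqr_ge0.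
apply: (@le_trans _ _ 0); last by rewrite fine_ge0.
rewrite subr_le0 ler_pdivlMr ?exprn_gt0// mul1r -(real_normK (num_real y)).
by rewrite lerXn2r// ?nnegrE//; exact: ltW.
Qed.

(** * Finite averages over all choices of signs *)

(** The expectation of [f] at a Rademacher sum with coefficients [l]. The recursion lets the
    summands be replaced one by one without any probability space. *)
Fixpoint sign_mean {R : realType} (l : seq R) (f : R -> R) : R :=
  if l is a :: l' then
    (sign_mean l' (fun x => f (x + a)) + sign_mean l' (fun x => f (x - a))) / 2
  else f 0.

Lemma eq_sign_mean (R : realType) (l : seq R) (f g : R -> R) :
  f =1 g -> sign_mean l f = sign_mean l g.
Proof.
by elim: l f g => [|a l IH] f g fg /=; [exact: fg | congr ((_ + _) / 2); exact: IH].
Qed.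

Lemma le_sign_mean (R : realType) (l : seq R) (f g : R -> R) :
  (forall x, f x <= g x) -> sign_mean l f <= sign_mean l g.
Proof.
elim: l f g => [|a l IH] f g fg /=; first exact: fg.
by rewrite ler_pM2r// lerD// IH.
Qed.

Lemma sign_meanD (R : realType) (l : seq R) (f g : R -> R) :
  sign_mean l (fun x => f x + g x) = sign_mean l f + sign_mean l g.
Proof. by elim: l f g => [//|a l IH] f g /=; rewrite !IH; field. Qed.

Lemma sign_meanZ (R : realType) (l : seq R) (c : R) (f : R -> R) :
  sign_mean l (fun x => c * f x) = c * sign_mean l f.
Proof. by elim: l f => [//|a l IH] f /=; rewrite !IH; field. Qed.

Lemma sign_mean_cst (R : realType) (l : seq R) (c : R) :
  sign_mean l (fun _ => c) = c.
Proof. by elim: l => [//|a l IH] /=; rewrite !IH; field. Qed.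

Lemma sign_mean_exchange (R : realType) (l1 l2 : seq R) (f : R -> R -> R) :
  sign_mean l1 (fun x => sign_mean l2 (f x)) =
  sign_mean l2 (fun y => sign_mean l1 (f^~ y)).
Proof.
elim: l1 f => [//|a l1 IH] f /=.
rewrite (IH (fun x => f (x + a))) (IH (fun x => f (x - a))) -sign_meanD mulrC.
by rewrite -sign_meanZ; apply: eq_sign_mean => y /=; rewrite mulrC.
Qed.

Lemma sign_mean_cat (R : realType) (l1 l2 : seq R) (f : R -> R) :
  sign_mean (l1 ++ l2) f =
  sign_mean l2 (fun y => sign_mean l1 (fun x => f (x + y))).
Proof.
rewrite -sign_mean_exchange; elim: l1 f => [|a l1 IH] f /=.
  by apply: eq_sign_mean => x; rewrite add0r.
rewrite !IH.
congr ((_ + _) / 2); apply: eq_sign_mean => x; apply: eq_sign_mean => y;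
  by congr f; ring.
Qed.

(** Gives the freedom to choose which block, or which dominant summand, is replaced first. *)
Lemma sign_mean_catC (R : realType) (l1 l2 : seq R) (f : R -> R) :
  sign_mean (l1 ++ l2) f = sign_mean (l2 ++ l1) f.
Proof.
rewrite !sign_mean_cat sign_mean_exchange; apply: eq_sign_mean => x.
by apply: eq_sign_mean => y; rewrite addrC.
Qed.

Lemma sign_meanN (R : realType) (l : seq R) (f : R -> R) :
  sign_mean l (fun x => f (- x)) = sign_mean l f.
Proof.
elim: l f => [|a l IH] f /=; first by rewrite oppr0.
rewrite -(IH (fun x => f (x + a))) -(IH (fun x => f (x - a))) addrC.
by congr ((_ + _) / 2); apply: eq_sign_mean => x; congr f; ring.
Qed.

Lemma sign_mean_sqr (R : realType) (l : seq R) (t : R) :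
  sign_mean l (fun x => (x + t) ^+ 2) = \sum_(a <- l) a ^+ 2 + t ^+ 2.
Proof.
elim: l t => [|a l IH] t /=; first by rewrite big_nil !add0r.
have := IH (a + t); have := IH (t - a).
under eq_sign_mean do rewrite addrA addrAC.
under [X in _ -> X = _ -> _]eq_sign_mean do rewrite addrA.
by move=> -> ->; rewrite big_cons; field.
Qed.

(** * Successive replacement of the signs by Gaussians *)

(** [smooth_cube_step] at [x + t], averaged over the signs still present; [tau] is the variance of
    the summands already replaced. *)
Lemma sign_mean_cons_smooth (R : realType) (a : R) (l : seq R) (tau t : R) :
  0 <= tau -> 0 <= a ->
  sign_mean (a :: l) (fun x => smooth_cube tau (x + t)) +
  gain_const R * a ^+ 3 * sign_mean l (fun x => fine (normal_prob (0 : R) 1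
     [set h | `|x + t + Num.sqrt tau * h| <= a])) <=
  sign_mean l (fun x => smooth_cube (tau + a ^+ 2) (x + t)).
Proof.
move=> tau0 a0; rewrite /= -sign_meanD mulrC -!sign_meanZ -sign_meanD.
apply: le_sign_mean => x; have := smooth_cube_step (x + t) tau0 a0.
by rewrite [x + a + t]addrAC [x - a + t]addrAC; lra.
Qed.

Lemma sumr_sqr_ge0 (R : realType) (l : seq R) (n : nat) :
  (forall a, a \in l -> 0 <= a) -> 0 <= \sum_(a <- l) a ^+ n.
Proof.
by move=> l0; rewrite big_seq sumr_ge0// => a al; rewrite exprn_ge0// l0.
Qed.

Lemma sign_mean_smooth_le (R : realType) (l : seq R) (tau t : R) :
  (forall a, a \in l -> 0 <= a) -> 0 <= tau ->
  sign_mean l (fun x => smooth_cube tau (x + t)) <=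
  smooth_cube (tau + \sum_(a <- l) a ^+ 2) t.
Proof.
elim: l tau => [|a l IH] tau l0 tau0; first by rewrite big_nil addr0 /= add0r.
have a0 : 0 <= a by rewrite l0// mem_head.
have l0' b : b \in l -> 0 <= b by move=> bl; rewrite l0// inE bl orbT.
rewrite big_cons addrA; apply: le_trans (IH _ l0' _); last first.
  by rewrite addr_ge0 ?sqr_ge0.
apply: le_trans (sign_mean_cons_smooth l t tau0 a0).
rewrite lerDl; apply: mulr_ge0.
  by rewrite mulr_ge0 ?exprn_ge0// ltW ?gain_const_gt0.
rewrite -(sign_mean_cst l 0); apply: le_sign_mean => x.
by rewrite fine_ge0.
Qed.

Definition smooth_gain_const (R : realType) : R :=
  gain_const R * normal_pdf 0 1 9.

Lemma smooth_gain_const_gt0 (R : realType) : 0 < smooth_gain_const R.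
Proof. by rewrite mulr_gt0 ?gain_const_gt0 ?normal_pdf_gt0 ?oner_eq0. Qed.

(** Replacing [a] gains [a ^ 3] times a mean small-ball probability, itself of order [a] by
    [small_ball_smooth]. The bound [1 / 8 <= tau] persists because [tau] only grows. *)
Lemma sign_mean_smooth_gain (R : realType) (l : seq R) (tau t : R) :
  (forall a, a \in l -> 0 <= a) -> 1 / 8 <= tau ->
  tau + \sum_(a <- l) a ^+ 2 <= 1 -> `|t| <= 1 / 2 ->
  sign_mean l (fun x => smooth_cube tau (x + t)) +
  smooth_gain_const R * \sum_(a <- l) a ^+ 4 <=
  smooth_cube (tau + \sum_(a <- l) a ^+ 2) t.
Proof.
move=> + + + t2; elim: l tau => [|a l IH] tau l0 tau8.
  by rewrite !big_nil addr0 /= add0r mulr0 addr0.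
have a0 : 0 <= a by rewrite l0// mem_head.
have l0' b : b \in l -> 0 <= b by move=> bl; rewrite l0// inE bl orbT.
rewrite !big_cons addrA => sum1.
have S2 := sumr_sqr_ge0 2 l0'.
have aa := sqr_ge0 a.
have tau1 : 1 / 8 <= tau <= 1 by apply/andP; split; lra.
have a1 : 0 <= a <= 1 by apply/andP; split => //; nra.
have t4 : t ^+ 2 <= 1 / 4.
  by move: t2; rewrite ler_norml => /andP[? ?]; nra.
apply: le_trans (IH (tau + a ^+ 2) l0' _ sum1); last by lra.
have tau0 : 0 <= tau by lra.
have := sign_mean_cons_smooth l t tau0 a0.
set X := sign_mean (a :: l) _; set Y := sign_mean l _; set Z := sign_mean l _.
move=> H.
suff : smooth_gain_const R * a ^+ 4 <= gain_const R * a ^+ 3 * Y by lra.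
have k0 := gain_const_gt0 R.
have ga3 : 0 <= gain_const R * a ^+ 3 by rewrite mulr_ge0 ?exprn_ge0// ltW.
rewrite /smooth_gain_const [a ^+ 4]exprSr mulrACA ler_wpM2l//.
have p9 : 0 < normal_pdf (0 : R) 1 9 by rewrite normal_pdf_gt0 ?oner_eq0.
apply: (@le_trans _ _ (sign_mean l (fun x =>
    2 * normal_pdf 0 1 9 * a + (- (2 * normal_pdf 0 1 9 * a) / 4) * (x + t) ^+ 2))).
  rewrite sign_meanD sign_mean_cst sign_meanZ sign_mean_sqr.
  (* This is the surplus over [normal_pdf 0 1 9 * a]; the mean of [(x + t) ^ 2] is at most
     [7 / 8 + 1 / 4]. *)
  have : 0 <= normal_pdf 0 1 9 * a * (1 - (\sum_(b <- l) b ^+ 2 + t ^+ 2) / 2).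
    by apply: mulr_ge0; [rewrite mulr_ge0// ltW | lra].
  by lra.
apply: le_sign_mean => x.
by apply: le_trans (small_ball_smooth (x + t) tau1 a1); lra.
Qed.

(** Cut as soon as the running sum, started at [s], reaches [1 / 8]. It was below [1 / 8] one term
    earlier, so it is now below [7 / 8] and more than [1 / 8] remains. *)
Lemma cut_sum_sqr (R : realType) (l : seq R) (s : R) :
  (forall a, a \in l -> a ^+ 2 <= 3 / 4) -> s < 1 / 8 ->
  s + \sum_(a <- l) a ^+ 2 = 1 ->
  exists l1 l2, [/\ l = l1 ++ l2, 1 / 8 <= s + \sum_(a <- l1) a ^+ 2 &
    1 / 8 <= \sum_(a <- l2) a ^+ 2].
Proof.
elim: l s => [|a l IH] s l34 s8; first by rewrite big_nil; lra.
rewrite big_cons addrA => s1.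
have a34 : a ^+ 2 <= 3 / 4 by rewrite l34// mem_head.
have l34' b : b \in l -> b ^+ 2 <= 3 / 4 by move=> bl; rewrite l34// inE bl orbT.
have [sa|sa] := leP (1 / 8) (s + a ^+ 2).
  by exists [:: a], l; split => //; rewrite ?big_seq1//; lra.
have [l1 [l2 [-> h1 h2]]] := IH _ l34' sa s1.
by exists (a :: l1), l2; split => //; rewrite big_cons addrA.
Qed.

(** The first entry comes from averaging two orders of replacement, the second from the single
    replacement of a dominant summand. *)
Definition cube_gain_const (R : realType) : R :=
  Num.min (smooth_gain_const R / 2) (gain_const R / 6).

Lemma cube_gain_const_gt0 (R : realType) : 0 < cube_gain_const R.
Proof.
have := smooth_gain_const_gt0 R; have := gain_const_gt0 R.
by rewrite lt_min => ? ?; apply/andP; split; lra.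
Qed.

(** Replacing [l1] first, with its gain dropped, provides the smoothing of variance at least [1 / 8]
    under which every term of [l2] yields a gain. *)
Lemma sign_mean_cubepos_cut (R : realType) (l1 l2 : seq R) (t : R) :
  (forall a, a \in l1 ++ l2 -> 0 <= a) ->
  1 / 8 <= \sum_(a <- l1) a ^+ 2 ->
  \sum_(a <- l1 ++ l2) a ^+ 2 = 1 -> `|t| <= 1 / 2 ->
  sign_mean (l1 ++ l2) (fun x => cubepos (x + t)) +
  smooth_gain_const R * \sum_(a <- l2) a ^+ 4 <= smooth_cube 1 t.
Proof.
move=> l0 h1 sum1 t2.
have l10 a : a \in l1 -> 0 <= a by move=> al; rewrite l0// mem_cat al.
have l20 a : a \in l2 -> 0 <= a by move=> al; rewrite l0// mem_cat al orbT.
have := sum1; rewrite big_cat/= => sum12.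
have := sign_mean_smooth_gain l20 h1; rewrite sum12 lexx => /(_ _ isT t2).
apply: le_trans; rewrite lerD2r sign_mean_cat; apply: le_sign_mean => y.
have := sign_mean_smooth_le (y + t) l10 (lexx 0); rewrite add0r; apply: le_trans.
by apply: le_sign_mean => x; rewrite smooth_cube0 addrA.
Qed.

(* If no summand dominates, the sequence is cut into two pieces of variance at
   least [1/8]; replacing either piece first yields the gain for the other. *)
Lemma sign_mean_cubepos_le (R : realType) (l : seq R) (t : R) :
  (forall a, a \in l -> 0 <= a) -> \sum_(a <- l) a ^+ 2 = 1 -> `|t| <= 1 / 2 ->
  sign_mean l (fun x => cubepos (x + t)) +
  cube_gain_const R * \sum_(a <- l) a ^+ 4 <= smooth_cube 1 t.
Proof.
move=> l0 sum1 t2.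
have S4 := sumr_sqr_ge0 4 l0.
have kg := gain_const_gt0 R.
have [/hasP[a al a34]|] := boolP (has (fun a : R => 3 / 4 <= a ^+ 2) l).
- have S41 : \sum_(a <- l) a ^+ 4 <= 1.
    rewrite -sum1 !big_seq; apply: ler_sum => b bl.
    have b0 := sqr_ge0 b.
    have b1 : b ^+ 2 <= 1.
      rewrite -sum1 (big_rem b bl)/= lerDl big_seq sumr_ge0// => c _.
      exact: sqr_ge0.
    by rewrite (_ : 4 = 2 + 2)%N// exprD; nra.
  move: al l0 sum1 S4 S41 => /splitPr[l1 l2] l0 sum1 S4 S41.
  rewrite sign_mean_catC cat_cons; set l' := l2 ++ l1.
  have a0 : 0 <= a by rewrite l0// mem_cat mem_head orbT.
  have l0' b : b \in l' -> 0 <= b.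
    by rewrite mem_cat => /orP[] bl; rewrite l0// mem_cat inE bl ?orbT.
  have sum1' : a ^+ 2 + \sum_(b <- l') b ^+ 2 = 1.
    by rewrite -sum1 !big_cat/= big_cons; ring.
  have ap : 0 < a.
    rewrite lt_neqAle a0 andbT; apply/eqP => a00.
    by move: a34; rewrite -a00 expr0n/=; lra.
  have tau0 : 0 <= a ^+ 2 := sqr_ge0 a.
  (* The dominant summand [a] is replaced first, before any smoothing; the others follow and their
     gains are dropped. *)
  have := sign_mean_smooth_le t l0' tau0; rewrite sum1'; apply: le_trans.
  have := sign_mean_cons_smooth l' t (lexx 0) a0; rewrite add0r; apply: le_trans.
  apply: lerD.
    by apply: le_sign_mean => x; rewrite smooth_cube0.
  have t4 : t ^+ 2 <= 1 / 4.
    by move: t2; rewrite ler_norml => /andP[? ?]; nra.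
  (* [1 / 6] is [1 / 2 * (1 / 3)]: [a ^ 3 >= 1 / 2], and the mean small-ball probability is at least
     [1 / 3], since the mean of [(x + t) ^ 2] is at most [1 / 4 + 1 / 4] while [a ^ 2 >= 3 / 4]. *)
  apply: (@le_trans _ _ (gain_const R / 6)).
    apply: (@le_trans _ _ (cube_gain_const R * 1)).
      by rewrite ler_wpM2l// ltW// cube_gain_const_gt0.
    by rewrite mulr1 ge_min lexx orbT.
  rewrite -mulrA ler_pM2l//.
  apply: (@le_trans _ _ (a ^+ 3 * (1 / 3))).
    have : 1 / 2 <= a ^+ 3 by rewrite exprS; nra.
    by lra.
  rewrite ler_pM2l ?exprn_gt0//.
  apply: (@le_trans _ _
    (sign_mean l' (fun x => 1 + (- (a ^+ 2)^-1) * (x + t) ^+ 2))).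
    rewrite sign_meanD sign_mean_cst sign_meanZ sign_mean_sqr mulNr.
    have : (\sum_(b <- l') b ^+ 2 + t ^+ 2) / a ^+ 2 <= 2 / 3.
      by rewrite ler_pdivrMr ?exprn_gt0//; lra.
    by rewrite mulrC; lra.
  apply: le_sign_mean => x; apply: le_trans (small_ball_dirac (x + t) ap).
  by rewrite mulNr mulrC.
move=> /hasPn nl.
have l34 a : a \in l -> a ^+ 2 <= 3 / 4 by move=> /nl; rewrite -ltNge => /ltW.
have s08 : 0 < 1 / 8 :> R by lra.
have := @cut_sum_sqr _ l 0 l34 s08; rewrite add0r => /(_ sum1).
move=> [l1 [l2 [ll h1 h2]]]; rewrite add0r in h1.
rewrite {}ll in l0 sum1 S4 *.
have H1 := sign_mean_cubepos_cut l0 h1 sum1 t2.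
have l0C a : a \in l2 ++ l1 -> 0 <= a.
  by rewrite mem_cat orbC -mem_cat; exact: l0.
have sum1C : \sum_(a <- l2 ++ l1) a ^+ 2 = 1 by rewrite -sum1 !big_cat/= addrC.
have := sign_mean_cubepos_cut l0C h2 sum1C t2; rewrite sign_mean_catC => H2.
have k : cube_gain_const R * \sum_(a <- l1 ++ l2) a ^+ 4 <=
    smooth_gain_const R / 2 * \sum_(a <- l1 ++ l2) a ^+ 4.
  by rewrite ler_wpM2r// ge_min lexx.
by move: S4 H1 H2 k; rewrite !big_cat/=; lra.
Qed.

(** * Powers as integrals of truncated cubes *)

Lemma measurable_layer (R : realType) (x r : R) (D : set R) :
  measurable_fun D (fun w : R => (cubepos (x - w `^ r))%:E).
Proof.
apply: measurable_funTS; apply/measurable_EFinP.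
apply: (measurableT_comp (@measurable_cubepos R)).
by apply: measurable_funB => //; exact: measurable_powR.
Qed.

Definition layer_const {R : realType} (r : R) : R :=
  fine (\int[lebesgue_measure]_(u in `[0%R, +oo[) (cubepos (1 - u `^ r))%:E).

(** On the half line the integrand is at most [1] and vanishes beyond [1]. *)
Lemma layer_const_fin_num (R : realType) (r : R) : 0 < r ->
  (\int[lebesgue_measure]_(u in `[0%R, +oo[) (cubepos (1 - u `^ r))%:E)%E
  \is a fin_num.
Proof.
move=> r0; rewrite ge0_fin_numE; last first.
  by apply: integral_ge0 => u _; rewrite lee_fin cubepos_ge0.
apply: (@le_lt_trans _ _
  (\int[lebesgue_measure]_(u in `[0%R, +oo[) (\1_`[0, 1] u : R)%:E)%E).
  apply: ge0_le_integral => //.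
  - by move=> u _; rewrite lee_fin cubepos_ge0.
  - exact: measurable_layer.
  - by apply/measurable_EFinP; exact: measurable_indic.
  - move=> u /=; rewrite in_itv/= andbT => u0; rewrite lee_fin indicE.
    have [u1|u1] := leP u 1.
      rewrite mem_set; last by rewrite /= in_itv/= u0.
      have h : 0 <= u `^ r := powR_ge0 _ _.
      have [k|k] := leP (1 - u `^ r) 0; first by rewrite cubepos_neg.
      by have k' := ltW k; rewrite cubepos_pos// exprn_ile1//; lra.
    rewrite cubepos_neg// subr_le0; apply: (@le_trans _ _ (1 `^ r)).
      by rewrite powR1.
    by apply: ge0_ler_powR; rewrite ?nnegrE//; exact: ltW.
rewrite integral_indic//.
apply: (@le_lt_trans _ _ (lebesgue_measure (`[0, 1]%classic : set R))).
  by apply: le_measure; rewrite ?inE//; exact: measurableI.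
by rewrite lebesgue_measure_itv/= lte01 -EFinB ltry.
Qed.

Lemma layer_const_gt0 (R : realType) (r : R) : 0 < r -> 0 < layer_const r.
Proof.
move=> r0; rewrite -lte_fin fineK ?layer_const_fin_num//.
(* Chosen so that [v] to the power [r] is [1 / 2]: on [[0, v]] the integrand is at least
   [(1 / 2) ^ 3 = 1 / 8]. *)
pose v : R := (1 / 2) `^ r^-1.
have v0 : 0 < v by rewrite powR_gt0; lra.
apply: (@lt_le_trans _ _
  (\int[lebesgue_measure]_(u in `[0%R, v]) (cst (1 / 8)%:E u))%E).
  rewrite integral_cst//= lebesgue_measure_itv/= lte_fin v0 -EFinB -EFinM lte_fin.
  by rewrite subr0 mulr_gt0//; lra.
apply: (@le_trans _ _
  (\int[lebesgue_measure]_(u in `[0%R, v]) (cubepos (1 - u `^ r))%:E)%E).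
  apply: ge0_le_integral => //.
  - by move=> u _; rewrite lee_fin; lra.
  - exact: measurable_layer.
  - move=> u /=; rewrite in_itv/= => /andP[u0 uv]; rewrite lee_fin.
    have h : u `^ r <= 1 / 2.
      rewrite [leRHS](_ : _ = v `^ r).
        by apply: ge0_ler_powR; rewrite ?nnegrE//; exact: ltW.
      by rewrite -powRrM mulVf ?gt_eqF// powRr1; lra.
    rewrite cubepos_pos; last by lra.
    move: (u `^ r) h => w h; have : 1 / 2 <= 1 - w by lra.
    by move: (1 - w) => z z2; rewrite exprS; nra.
apply: ge0_subset_integral => //.
- exact: measurable_layer.
- by move=> u _; rewrite lee_fin cubepos_ge0.
- by move=> u /=; rewrite !in_itv/= => /andP[-> _].
Qed.

(* Both sides scale alike under [w = x `^ r^-1 * u]. *)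
Lemma integral_layer (R : realType) (r x : R) : 0 < r -> 0 <= x ->
  (\int[lebesgue_measure]_(w in `[0%R, +oo[) (cubepos (x - w `^ r))%:E =
   (layer_const r * (x ^+ 3 * x `^ r^-1))%:E)%E.
Proof.
move=> r0; rewrite le_eqVlt => /predU1P[<-|x0].
  rewrite expr0n/= mul0r mulr0; apply: integral0_eq => w _.
  by rewrite cubepos_neg// sub0r oppr_le0 powR_ge0.
set X := x `^ r^-1; have X0 : 0 < X by rewrite powR_gt0.
have Xr : X `^ r = x by rewrite -powRrM mulVf ?gt_eqF// powRr1// ltW.
pose F (u : R^o) : R^o := u * X.
have F'E : F^`()%classic = cst X.
  apply/funext => u; rewrite /F derive1E deriveM// derive_cst.
  by rewrite derive_id scaler0 add0r scaler1.
have dF (u : R^o) : derivable F u 1 by [].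
have cF : continuous F.
  by move=> u; exact/differentiable_continuous/derivable1_diffP/dF.
have F0 : F 0 = 0 by rewrite /F mul0r.
have cG : {within `[F 0, +oo[, continuous (fun w : R => cubepos (x - w `^ r))}.
  rewrite F0; apply/continuous_within_itvcyP; split.
    move=> w w0.
    apply: (@continuous_comp _ _ _ (fun w : R => x - w `^ r) (@cubepos R)).
      2: exact: continuous_cubepos.
    have : {for w, continuous (fun w : R^o => w `^ r : R^o)}.
      by apply: differentiable_continuous; apply/derivable1_diffP;
        exact: derivable_powR.
    by apply: cvgB; exact: cvg_cst.
  rewrite powR0 ?gt_eqF//.
  apply: (@cvg_comp _ _ _ (fun w : R => x - w `^ r) (@cubepos R) _ (nbhs (x - 0))).
    by apply: cvgB; [exact: cvg_cst | exact: powR_cvg0].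
  exact: continuous_cubepos.
have := @increasing_ge0_integration_by_substitutiony _ F _ 0 _ _ _ _ _ _ cG.
rewrite F0 => ->; first last.
- by move=> w _; exact: cubepos_ge0.
- exact: (gt0_cvgMly X0 cvg_id).
- split; first by move=> u _; exact: dF.
  by apply: cvg_at_right_filter; exact: cF.
- by rewrite F'E; exact: is_cvg_cst.
- by rewrite F'E; exact: is_cvg_cst.
- by rewrite F'E => ? _; exact: cvg_cst.
- by move=> u v _ _ uv; rewrite /F ltr_pM2r.
transitivity (\int[lebesgue_measure]_(u in `[0%R, +oo[)
    ((x ^+ 3 * X)%:E * (cubepos (1 - u `^ r))%:E))%E.
  apply: eq_integral => u; rewrite inE/= in_itv/= andbT => u0.
  rewrite F'E -EFinM; congr EFin; rewrite -[LHS]/(cubepos (x - (u * X) `^ r) * X).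
  rewrite powRM//; last exact: ltW.
  rewrite Xr (_ : x - u `^ r * x = x * (1 - u `^ r)); last by ring.
  by rewrite cubeposM; [ring | exact: ltW].
rewrite ge0_integralZl//.
- by rewrite -(fineK (layer_const_fin_num r0)) -EFinM mulrC.
- exact: measurable_layer.
- by move=> u _; rewrite lee_fin cubepos_ge0.
- by rewrite lee_fin mulr_ge0 ?exprn_ge0 ?powR_ge0// ltW.
Qed.

(** Integrate [integral_layer] at [x = X t] over [t] and exchange by Tonelli. The half line becomes
    an indicator factor, so that the product is taken with Lebesgue measure on the whole line. *)
Lemma layer_cake (R : realType) d (T : measurableType d) (P : probability T R)
    (X : T -> R) (r : R) :
  measurable_fun [set: T] X -> 0 < r -> (forall t, 0 <= X t) ->
  (\int[lebesgue_measure]_(w in `[0%R, +oo[)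
     \int[P]_t (cubepos (X t - w `^ r))%:E =
   (layer_const r)%:E * \int[P]_t (X t ^+ 3 * X t `^ r^-1)%:E)%E.
Proof.
move=> mX r0 X0.
rewrite -ge0_integralZl//; last 3 first.
- apply/measurable_EFinP; apply: measurable_funM.
    exact: measurable_funX.
  exact: (measurableT_comp (@measurable_powR R r^-1) mX).
- by move=> t _; rewrite lee_fin mulr_ge0 ?exprn_ge0 ?powR_ge0.
- by rewrite lee_fin ltW ?layer_const_gt0.
under [RHS]eq_integral => t _ do rewrite -EFinM -integral_layer// integral_mkcond.
rewrite [LHS]integral_mkcond.
pose f (z : T * R) : \bar R :=
  ((cubepos (X z.1 - z.2 `^ r))%:E * (\1_`[0%R, +oo[ z.2 : R)%:E)%E.
have mf : measurable_fun [set: T * measurableTypeR R] f.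
  apply: emeasurable_funM.
    apply/measurable_EFinP; apply: (measurableT_comp (@measurable_cubepos R)).
    apply: measurable_funB; first exact: measurableT_comp.
    exact: (measurableT_comp (@measurable_powR R r)).
  by apply/measurable_EFinP; apply: measurableT_comp => //; exact: measurable_indic.
have f0 z : (0 <= f z)%E by rewrite mule_ge0// lee_fin ?cubepos_ge0.
transitivity (\int[lebesgue_measure]_w \int[P]_t f (t, w))%E.
  apply: eq_integral => w _; rewrite epatch_indic /f /=.
  rewrite ge0_integralZr//.
  - apply/measurable_EFinP; apply: (measurableT_comp (@measurable_cubepos R)).
    exact: measurable_funB.
  - by move=> t _; rewrite lee_fin cubepos_ge0.
rewrite -(@fubini_tonelli _ _ _ _ _ P lebesgue_measure _ mf f0).
by apply: eq_integral => t _; apply: eq_integral => w _; rewrite epatch_indic.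
Qed.

(** * From independent Rademacher variables to averages over signs *)

(** Only the coordinates in [J] are prescribed, so that signs can be revealed one at a time. *)
Definition sign_event d (T : measurableType d) (R : realType)
    (P : probability T R) (I : finType) (X : I -> {RV P >-> R})
    (J : {set I}) (v : I -> R) : set T :=
  \bigcap_(i in [set` J]) (X i @^-1` [set v i]).

Lemma sign_event_measurable d (T : measurableType d) (R : realType)
    (P : probability T R) (I : finType) (X : I -> {RV P >-> R})
    (J : {set I}) (v : I -> R) : measurable (sign_event X J v).
Proof. by apply: fin_bigcap_measurable. Qed.

Lemma prob_sign_event d (T : measurableType d) (R : realType)
    (P : probability T R) (I : finType) (X : I -> {RV P >-> R})
    (J : {set I}) (v : I -> R) :
  mutually_independent X -> (forall i, rademacher (X i)) ->
  (forall i, v i = 1 \/ v i = -1) -> P (sign_event X J v) = (2^-1 ^+ #|J|)%:E.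
Proof.
move=> indepX radX v1; rewrite indepX//.
rewrite (eq_bigr (fun=> (2^-1)%:E)); last first.
  by move=> i _; have [r1 r2] := radX i; case: (v1 i) => ->.
by rewrite prodEFin prodr_const.
Qed.

(** The two atoms of mass [1 / 2] exhaust the probability; [rademacher] restricts the values of [X]
    only up to a null set. *)
Lemma rademacher_null d (T : measurableType d) (R : realType)
    (P : probability T R) (X : {RV P >-> R}) : rademacher X ->
  P (~` (X @^-1` [set 1] `|` X @^-1` [set -1])) = 0%E.
Proof.
move=> [X1 XN1]; rewrite probability_setC; last exact: measurableU.
rewrite measureU//; last first.
  apply/seteqP; split => // t [/= -> /eqP]; rewrite -subr_eq0 opprK; apply/negP.
  by rewrite -(natrD _ 1 1) pnatr_eq0.
transitivity (1 - ((2^-1)%:E + (2^-1)%:E) : \bar R)%E.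
  by congr (_ - (_ + _))%E.
by rewrite -[LHS]/((1 - (2^-1 + 2^-1))%:E); congr EFin; lra.
Qed.

(** Induction on the list [s] of signs not yet revealed. Off a null set the event splits according
    to the value of the next sign, which enlarges [J] by one index, halves the weight and moves the
    revealed term into the shift [x]. *)
Lemma integral_sign_event d (T : measurableType d) (R : realType)
    (P : probability T R) (I : finType) (X : I -> {RV P >-> R})
    (a : I -> R) (f : R -> R) (s : seq I) (J : {set I}) (v : I -> R) (x : R) :
  mutually_independent X -> (forall i, rademacher (X i)) ->
  measurable_fun [set: R] f -> (forall y, 0 <= f y) ->
  uniq s -> {in s, forall i, i \notin J} -> (forall i, v i = 1 \/ v i = -1) ->
  (\int[P]_(t in sign_event X J v) (f (x + \sum_(i <- s) a i * X i t))%:E =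
   (2^-1 ^+ #|J| * sign_mean (map a s) (fun y => f (x + y)))%:E)%E.
Proof.
move=> indepX radX mf f0; elim: s J v x => [|i s IH] J v x.
  move=> _ _ v1; under eq_integral do rewrite big_nil addr0.
  rewrite integral_cst; last exact: sign_event_measurable.
  transitivity ((f x)%:E * (2^-1 ^+ #|J|)%:E)%E.
    by congr (_ * _)%E; exact: prob_sign_event.
  by rewrite -EFinM /= addr0 mulrC.
move=> /= /andP[iNs us] sJ v1.
have iJ : i \notin J by rewrite sJ// mem_head.
pose w c j : R := if j == i then c else v j.
pose E c := sign_event X (i |: J)%SET (w c).
have EE c : E c = sign_event X J v `&` X i @^-1` [set c].
  apply/seteqP; split => t.
    move=> H; split.
      move=> j /= jJ; have := H j; rewrite /= /w.
      by rewrite ifN ?in_setU1 ?jJ ?orbT; [exact | apply: contraNneq iJ => <-].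
    by have := H i; rewrite /= /w eqxx setU11; exact.
  move=> [H1 H2] j /=; rewrite in_setU1 /w.
  case: eqVneq => [-> _|_ /=]; first exact: H2.
  exact: H1.
have mE c : measurable (E c) by exact: sign_event_measurable.
have mg y (s' : seq I) (D : set T) :
    measurable_fun D (fun t => (f (y + \sum_(j <- s') a j * X j t))%:E).
  apply: measurable_funTS; apply/measurable_EFinP; apply: (measurableT_comp mf).
  apply: measurable_funD => //; apply: measurable_sum => j.
  exact: measurable_funM.
have null := rademacher_null (radX i).
rewrite (@ge0_negligible_integral _ _ _ P _ _ _ _ _ _ _ null)//; last 3 first.
- by apply: measurableC; exact: measurableU.
- exact: sign_event_measurable.
- by move=> t _; rewrite lee_fin.
rewrite setDE setCK setIUr -!EE ge0_integral_setU//; last 2 first.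
- by move=> t _; rewrite lee_fin.
- rewrite disj_set2E; apply/eqP; rewrite -subset0 !EE => t [[_ /= X1] [_ /= XN1]].
  by have := etrans (esym X1) XN1; lra.
have step c : c = 1 \/ c = -1 ->
  (\int[P]_(t in E c) (f (x + \sum_(j <- i :: s) a j * X j t))%:E =
   (2^-1 ^+ #|J|.+1 * sign_mean (map a s) (fun y => f (x + a i * c + y)))%:E)%E.
  move=> c1; have <- : #|(i |: J)%SET| = #|J|.+1 by rewrite cardsU1 iJ.
  rewrite -(IH (i |: J)%SET (w c) (x + a i * c))//; last 2 first.
  - move=> j js; rewrite in_setU1 negb_or sJ ?inE ?js ?orbT// andbT.
    by apply: contraNneq iNs => <-.
  - by move=> j; rewrite /w; case: eqP.
  apply: eq_integral => t; rewrite inE EE => -[_ /= Xi].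
  by rewrite big_cons Xi addrA.
rewrite !step; [|by right|by left].
rewrite -EFinD; congr EFin; rewrite mulr1 mulrN1 exprS.
rewrite (@eq_sign_mean _ _ (fun y => f (x + (y + a i)))
  (fun y => f (x + a i + y))); last first.
  by move=> y; congr f; ring.
rewrite (@eq_sign_mean _ _ (fun y => f (x + (y - a i)))
  (fun y => f (x - a i + y))); last first.
  by move=> y; congr f; ring.
by field.
Qed.

Lemma expectation_sign_mean d (T : measurableType d) (R : realType)
    (P : probability T R) n (X : 'I_n -> {RV P >-> R})
    (a : 'I_n -> R) (f : R -> R) :
  mutually_independent X -> (forall i, rademacher (X i)) ->
  measurable_fun [set: R] f -> (forall y, 0 <= f y) ->
  (\int[P]_t (f (\sum_(i < n) a i * X i t))%:E =
   (sign_mean [seq a i | i <- enum 'I_n] f)%:E)%E.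
Proof.
move=> indepX radX mf f0.
(* Start with no sign revealed: for empty [J] the event is the whole space. *)
have := @integral_sign_event _ _ _ _ _ X a f (enum 'I_n) finset.set0 (fun=> 1) 0
  indepX radX mf f0 (enum_uniq _).
rewrite (_ : sign_event _ _ _ = setT); last first.
  by apply/seteqP; split => // t _ i /=; rewrite inE.
rewrite cards0 expr0 mul1r => H.
under eq_integral do rewrite -big_enum -[\sum_(_ <- _) _]add0r.
rewrite H; last 2 first.
- by move=> i _; rewrite inE.
- by move=> i; left.
by congr EFin; apply: eq_sign_mean => y; rewrite add0r.
Qed.

(** * Comparison of the moments *)

(** For [t >= 0] at most one of the two tails is active, so the absolute value splits into two
    one-sided terms. *)
Lemma cubepos_normB (R : realType) (x t : R) : 0 <= t ->
  cubepos (`|x| - t) = cubepos (x - t) + cubepos (- x - t).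
Proof.
move=> t0; case: (ger0P x) => x0.
  by rewrite (@cubepos_neg _ (- x - t)) ?addr0//; lra.
by rewrite (@cubepos_neg _ (x - t)) ?add0r//; lra.
Qed.

Lemma sign_mean_cubepos_norm (R : realType) (l : seq R) (t : R) : 0 <= t ->
  sign_mean l (fun x => cubepos (`|x| - t)) =
  2 * sign_mean l (fun x => cubepos (x - t)).
Proof.
move=> t0; under eq_sign_mean do rewrite cubepos_normB//.
by rewrite sign_meanD (sign_meanN l (fun x => cubepos (x - t))); ring.
Qed.

Lemma integral_cubepos_norm (R : realType) (t : R) : 0 <= t ->
  (\int[normal_prob 0 1]_x (cubepos (`|x| - t))%:E =
   (2 * smooth_cube 1 (- t))%:E)%E.
Proof.
move=> t0; under eq_integral do rewrite cubepos_normB// EFinD.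
have cp0 (x : R) : (0 <= (cubepos x)%:E)%E by rewrite lee_fin cubepos_ge0.
have m1 : measurable_fun [set: R] (fun x : R => (cubepos (x - t))%:E).
  apply/measurable_EFinP; apply: (measurableT_comp (@measurable_cubepos R)).
  exact: measurable_funB.
have m2 : measurable_fun [set: R] (fun x : R => (cubepos (- x - t))%:E).
  apply/measurable_EFinP; apply: (measurableT_comp (@measurable_cubepos R)).
  by apply: measurable_funB => //; exact: oppr_measurable.
rewrite ge0_integralD//.
rewrite (@integral_normal_prob_opp _ (fun x : R => (cubepos (x - t))%:E))//.
have -> : (\int[normal_prob 0 1]_x (cubepos (x - t))%:E =
    (smooth_cube 1 (- t))%:E)%E.
  by rewrite smooth_cubeE sqrtr1; apply: eq_integral => x _; rewrite mul1r addrC.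
by rewrite -EFinD; congr EFin; ring.
Qed.

(** By symmetry both tails contribute equally, whence the factor [2]. The one-sided comparison at
    [-t] has a gain for [t <= 1 / 2]; beyond that, the version without gain is used. *)
Lemma sign_mean_cubepos_norm_le (R : realType) (l : seq R) (t : R) :
  (forall a, a \in l -> 0 <= a) -> \sum_(a <- l) a ^+ 2 = 1 -> 0 <= t ->
  ((sign_mean l (fun x => cubepos (`|x| - t)) +
   2 * cube_gain_const R * (t <= 1 / 2)%R%:R * \sum_(a <- l) a ^+ 4)%:E <=
  \int[normal_prob 0 1]_x (cubepos (`|x| - t))%:E)%E.
Proof.
move=> l0 sum1 t0; rewrite integral_cubepos_norm// lee_fin sign_mean_cubepos_norm//.
have [t2|t2] := leP t (1 / 2).
  have tN : `|- t| <= 1 / 2 by rewrite normrN ger0_norm.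
  by have := sign_mean_cubepos_le l0 sum1 tN; rewrite /=; lra.
have := sign_mean_smooth_le (- t) l0 (lexx 0); rewrite sum1 add0r.
under eq_sign_mean do rewrite smooth_cube0.
by rewrite /= mulr0 mul0r; lra.
Qed.

Lemma integral_standard_gaussian d (T : measurableType d) (R : realType)
    (P : probability T R) (G : {RV P >-> R}) (f : R -> R) :
  standard_gaussian G -> measurable_fun [set: R] f -> (forall x, 0 <= f x) ->
  (\int[P]_t (f (G t))%:E = \int[normal_prob 0 1]_x (f x)%:E)%E.
Proof.
move=> GN mf f0.
have mfE : measurable_fun [set: R] (fun x => (f x)%:E) by exact/measurable_EFinP.
rewrite -[LHS](@ge0_integral_distribution _ _ _ _ _ P G (fun x => (f x)%:E))//.
(* The identity carries [normal_prob] from one measurable structure on the reals to the one used for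
   the law of [G]. *)
have mid : measurable_fun [set: measurableTypeR R] (id : measurableTypeR R -> R).
  by move=> _ A mA; rewrite setTI.
transitivity (\int[pushforward (normal_prob 0 1)
    (id : measurableTypeR R -> R)]_x (f x)%:E)%E.
  by apply: eq_measure_integral => A mA _; exact: GN.
by rewrite ge0_integral_pushforward// => x _; rewrite lee_fin.
Qed.

Lemma expr3_powR (R : realType) (p x : R) : 3 < p -> 0 <= x ->
  x ^+ 3 * x `^ (p - 3) = x `^ p.
Proof.
move=> p3 x0; rewrite -powR_mulrn// -powRD; first by congr (_ `^ _); ring.
by apply/implyP => /eqP; rewrite (_ : 3%:R = 3 :> R)//; lra.
Qed.

(** For [p > 3], the power of [1 / 2] is the length of the range of levels [w] whose truncation
    point is at most [1 / 2]. For [p = 3], the comparison of cubes at [t = 0] is already the one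
    between moments. *)
Definition moment_gain_const {R : realType} (p : R) : R :=
  if p == 3 then 2 * cube_gain_const R
  else 2 * cube_gain_const R * (1 / 2) `^ (p - 3) / layer_const (p - 3)^-1.

Lemma moment_gain_const_gt0 (R : realType) (p : R) : 3 <= p ->
  0 < moment_gain_const p.
Proof.
move=> p3; have k0 := cube_gain_const_gt0 R; rewrite /moment_gain_const.
case: eqP => [_|/eqP pN3]; first by rewrite mulr_gt0.
have p3' : 0 < p - 3 by rewrite subr_gt0 lt_neqAle eq_sym pN3.
rewrite divr_gt0 ?layer_const_gt0 ?invr_gt0//.
by rewrite !mulr_gt0// powR_gt0.
Qed.

Lemma measurable_norm_powR (R : realType) (p : R) :
  measurable_fun [set: R] (fun x : R => `|x| `^ p).
Proof. exact: (measurableT_comp (@measurable_powR R p)). Qed.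

Lemma sign_mean_ge0 (R : realType) (l : seq R) (f : R -> R) :
  (forall x, 0 <= f x) -> 0 <= sign_mean l f.
Proof. by move=> f0; rewrite -(sign_mean_cst l 0) le_sign_mean. Qed.

Lemma measurable_sign_mean (R : realType) (l : seq R) (F : R -> R -> R) :
  (forall x, measurable_fun [set: R] (F^~ x)) ->
  measurable_fun [set: R] (fun w => sign_mean l (F w)).
Proof.
elim: l F => [|a l IH] F mF /=; first exact: mF.
apply: measurable_funM => //; apply: measurable_funD.
  by apply: (IH (fun w x => F w (x + a))) => x; exact: mF.
by apply: (IH (fun w x => F w (x - a))) => x; exact: mF.
Qed.

Lemma ge0_integral_sign_mean (R : realType) (D : set R) (l : seq R)
    (F : R -> R -> R) (I : R -> R) :
  measurable D -> (forall x, measurable_fun [set: R] (F^~ x)) ->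
  (forall w x, 0 <= F w x) ->
  (forall x, \int[lebesgue_measure]_(w in D) (F w x)%:E = (I x)%:E)%E ->
  (\int[lebesgue_measure]_(w in D) (sign_mean l (F w))%:E =
   (sign_mean l I)%:E)%E.
Proof.
move=> mD; elim: l F I => [|a l IH] F I mF F0 FI /=; first exact: FI.
have mS c : measurable_fun D (fun w => (sign_mean l (fun x => F w (x + c)))%:E).
  apply/measurable_funTS/measurable_EFinP.
  by apply: (measurable_sign_mean l (F := fun w x => F w (x + c))) => x; exact: mF.
have S0 c w : (0 <= (sign_mean l (fun x => F w (x + c)))%:E)%E.
  by rewrite lee_fin sign_mean_ge0.
have [mSa mSNa] := (mS a, mS (- a)); have [S0a S0Na] := (S0 a, S0 (- a)).
under eq_integral do rewrite mulrC EFinM EFinD.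
rewrite ge0_integralZl//; last 2 first.
- exact: emeasurable_funD.
- by move=> w _; exact: adde_ge0.
rewrite ge0_integralD//.
rewrite (IH (fun w x => F w (x + a)) (fun x => I (x + a)))//.
rewrite (IH (fun w x => F w (x - a)) (fun x => I (x - a)))//.
by rewrite -EFinD -EFinM mulrC.
Qed.

Lemma sign_mean_layer (R : realType) (l : seq R) (p : R) : 3 < p ->
  (\int[lebesgue_measure]_(w in `[0%R, +oo[)
     (sign_mean l (fun x => cubepos (`|x| - w `^ (p - 3)^-1)))%:E =
   (layer_const (p - 3)^-1 * sign_mean l (fun x => `|x| `^ p))%:E)%E.
Proof.
move=> p3; have r0 : 0 < (p - 3)^-1 by rewrite invr_gt0; lra.
rewrite -sign_meanZ; apply: ge0_integral_sign_mean => //.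
- by move=> x; apply/measurable_EFinP; exact: measurable_layer.
- by move=> w x; exact: cubepos_ge0.
- by move=> x; rewrite integral_layer// invrK expr3_powR.
Qed.

(** Integrate [sign_mean_cubepos_norm_le] over the levels [w], with [t] equal to [w] to the power
    [r]. *)
Lemma sign_mean_moment_le (R : realType) (l : seq R) (p : R) : 3 <= p ->
  (forall a, a \in l -> 0 <= a) -> \sum_(a <- l) a ^+ 2 = 1 ->
  ((sign_mean l (fun x => `|x| `^ p) +
    moment_gain_const p * \sum_(a <- l) a ^+ 4)%:E <=
   \int[normal_prob 0 1]_x (`|x| `^ p)%:E)%E.
Proof.
move=> p3 l0 sum1; rewrite /moment_gain_const; case: eqP => [->|/eqP pN3].
  have := sign_mean_cubepos_norm_le l0 sum1 (lexx 0).
  have cube (x : R) : cubepos (`|x| - 0) = `|x| `^ 3.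
    by rewrite subr0 cubepos_pos// -powR_mulrn.
  rewrite (eq_sign_mean _ cube); under eq_integral do rewrite cube.
  by rewrite (_ : 0 <= 1 / 2) ?mulr1//; lra.
have p3' : 0 < p - 3 by rewrite subr_gt0 lt_neqAle eq_sym pN3.
have p30 : 3 < p by lra.
set r := (p - 3)^-1; have r0 : 0 < r by rewrite invr_gt0.
set L := layer_const r; have L0 : 0 < L by exact: layer_const_gt0.
set S4 := \sum_(a <- l) a ^+ 4.
have S40 : 0 <= S4 by exact: sumr_sqr_ge0.
set K := 2 * cube_gain_const R.
have K0 : 0 < K by rewrite mulr_gt0 ?cube_gain_const_gt0.
set v : R := (1 / 2) `^ (p - 3).
have v0 : 0 < v by rewrite powR_gt0; lra.
have mabs : measurable_fun [set: measurableTypeR R] (fun x : R => `|x|).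
  exact: normr_measurable.
have LC := layer_cake (normal_prob (0 : R) 1) mabs r0 (fun x => normr_ge0 x).
have E3 (x : R) : `|x| ^+ 3 * `|x| `^ r^-1 = `|x| `^ p.
  by rewrite invrK expr3_powR.
have LCE : (\int[normal_prob 0 1]_x (`|x| ^+ 3 * `|x| `^ r^-1)%:E =
    \int[normal_prob 0 1]_x (`|x| `^ p)%:E)%E.
  by apply: eq_integral => x _; rewrite E3.
rewrite LCE in LC.
have SL := sign_mean_layer l p30; rewrite -/r -/L in SL LC.
(* Multiplied by [L], both moments become integrals over the levels [w]. *)
rewrite -(@lee_pmul2l _ L%:E)//.
rewrite -{}LC -EFinM mulrDr EFinD -{}SL.
(* The gain is written as an integral over levels too: [[0, v]] is where the truncation point is at
   most [1 / 2]. *)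
have -> : (L * (K * v / L * S4))%:E =
    (\int[lebesgue_measure]_(w in `[0%R, +oo[)
       ((K * S4)%:E * (\1_`[0%R, v] w)%:E))%E.
  rewrite ge0_integralZl//; last 2 first.
  - by apply/measurable_EFinP; exact: measurable_indic.
  - by rewrite lee_fin mulr_ge0// ltW.
  rewrite integral_indic// setIidl; last first.
    by move=> w /=; rewrite !in_itv/= => /andP[-> _].
  transitivity ((K * S4)%:E * v%:E)%E.
    by rewrite -EFinM; congr EFin; field; rewrite gt_eqF.
  congr (_ * _)%E; rewrite -[RHS]/(lebesgue_measure (`[0%R, v]%classic : set R)).
  by rewrite lebesgue_measure_itv/= lte_fin v0 -EFinB subr0.
have mS : measurable_fun [set: R] (fun w : R =>
    (sign_mean l (fun x => cubepos (`|x| - w `^ r)))%:E).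
  apply/measurable_EFinP.
  apply: (measurable_sign_mean l (F := fun w x => cubepos (`|x| - w `^ r))) => x.
  by apply/measurable_EFinP; exact: measurable_layer.
have mI : measurable_fun [set: R]
    (fun w : R => (K * S4)%:E * (\1_`[0%R, v] w)%:E)%E.
  by apply: emeasurable_funM => //; apply/measurable_EFinP; exact: measurable_indic.
have S0 (w : R) : (0 <= (sign_mean l (fun x => cubepos (`|x| - w `^ r)))%:E)%E.
  by rewrite lee_fin sign_mean_ge0// => x; exact: cubepos_ge0.
have I0 (w : R) : (0 <= (K * S4)%:E * (\1_`[0%R, v] w)%:E)%E.
  by rewrite mule_ge0// lee_fin mulr_ge0// ltW.
rewrite -ge0_integralD//; try exact: measurable_funTS.
apply: ge0_le_integral => //.
- by move=> w _; exact: adde_ge0.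
- exact/measurable_funTS/emeasurable_funD.
- pose k (z : R * R) := cubepos (`|z.2| - z.1 `^ r).
  have mk : measurable_fun [set: measurableTypeR R * measurableTypeR R] (EFin \o k).
    apply/measurable_EFinP; apply: (measurableT_comp (@measurable_cubepos R)).
    apply: measurable_funB; first exact: measurableT_comp.
    exact: (measurableT_comp (@measurable_powR R r)).
  have k0 z : (0 <= (EFin \o k) z)%E by rewrite lee_fin cubepos_ge0.
  apply: measurable_funTS; exact: (measurable_fun_fubini_tonelli_F
    (m2 := normal_prob (0 : R) 1 : {sigma_finite_measure set _ -> \bar R}) _ mk k0).
move=> w /=; rewrite in_itv/= andbT => w0.
have := sign_mean_cubepos_norm_le l0 sum1 (powR_ge0 w r).
apply: le_trans; rewrite -EFinM -EFinD lee_fin lerD2l -/K -/S4.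
rewrite [leRHS]mulrAC ler_wpM2l//; first by rewrite mulr_ge0// ltW.
rewrite indicE; case: (boolP (w \in _)) => // /[!inE] /=.
rewrite in_itv/= => /andP[_ wv].
suff -> : w `^ r <= 1 / 2 by [].
apply: (@le_trans _ _ (v `^ r)).
  by apply: ge0_ler_powR; rewrite ?nnegrE//; exact: ltW.
by rewrite -powRrM mulfV ?gt_eqF// powRr1//; lra.
Qed.

(* S and G may live on different probability spaces: only their laws matter. *)
Theorem theorem1 (R : realType) (p : R) (hp : 3 <= p) :
  exists C : R, 0 < C /\
  forall (n : nat) (a : 'I_n -> R),
    (1 <= n)%N ->
    (forall i j : 'I_n, (i <= j)%N -> a j <= a i) ->
    (forall i : 'I_n, 0 <= a i) ->
    \sum_(i < n) a i ^+ 2 = 1 ->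
  forall (d : measure_display) (T : measurableType d) (P : probability T R)
    (eps : 'I_n -> {RV P >-> R}),
    mutually_independent eps ->
    (forall i : 'I_n, rademacher (eps i)) ->
  forall (d' : measure_display) (T' : measurableType d')
    (P' : probability T' R) (G : {RV P' >-> R}),
    standard_gaussian G ->
  ('E_P[fun t => (`|\sum_(i < n) a i * eps i t| `^ p)%R] <=
   'E_P'[fun t => (`|G t| `^ p)%R] - (C * \sum_(i < n) a i ^+ 4)%:E)%E.
Proof.
exists (moment_gain_const p); split; first exact: moment_gain_const_gt0.
move=> n a _ _ a0 sum1 d T P eps indep rad d' T' P' G GN.
have pow0 (x : R) : 0 <= `|x| `^ p by exact: powR_ge0.
have mpow := @measurable_norm_powR R p.
pose l := [seq a i | i <- enum 'I_n].
have -> : 'E_P[fun t => (`|\sum_(i < n) a i * eps i t| `^ p)%R]%E =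
    (sign_mean l (fun x => `|x| `^ p))%:E.
  by rewrite unlock; exact: (expectation_sign_mean a indep rad mpow pow0).
have -> : 'E_P'[fun t => (`|G t| `^ p)%R]%E =
    (\int[normal_prob 0 1]_x (`|x| `^ p)%:E)%E.
  by rewrite unlock; exact: (integral_standard_gaussian GN mpow pow0).
rewrite leeBrDr// -EFinD.
have sumE k : \sum_(i < n) a i ^+ k = \sum_(x <- l) x ^+ k.
  by rewrite big_map big_enum.
rewrite sumE; apply: sign_mean_moment_le => //; last by rewrite -sumE.
by move=> x /mapP[i _ ->].
Qed.
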